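(* Let $G$ be a finite group of order $n$ and let $\xi$ be a primitive $n$-th root of unity in $\mathbb{C}$. Set $C:=\operatorname{Spec}(R(G)\otimes_{\mathbb{Z}}\mathbb{Z}[\xi])$, where $R(G)$ is the representation ring of $G$. Let $P\in C$ be a closed point, let $p$ be the prime number such that $p\in P\cap\mathbb{Z}$, and let $k_P$ be the residue field of $P$. Then the following hold. (i) If $p\mid n$ and either $p\neq 2$ or $4\mid n$, then $$\dim_{k_P}T_P(C/\mathbb{Z}[\xi])+1=\dim_{k_P}T_P(C/\mathbb{Z})=\operatorname{edim}_P(C).$$ (ii) If $p\nmid n$, or $p=2$ and $4\nmid n$, then $$\dim_{k_P}T_P(C/\mathbb{Z}[\xi])=\dim_{k_P}T_P(C/\mathbb{Z})=\operatorname{edim}_P(C)-1.$$ Furthermore, case (i) holds (that is, $p\mid n$ and either $p\ne 2$ or $4\mid n$) if and only if $p\in P^2$.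
   Context: The representation ring $R(G)$ is the commutative ring of $\mathbb{Z}$-linear combinations of the irreducible complex characters of $G$, with pointwise product of characters. The point $P$ is viewed as a prime ideal of $R(G)\otimes_{\mathbb{Z}}\mathbb{Z}[\xi]$, and $P^2$ is its square as an ideal. For a scheme $X$ over $Y$ and a point $P\in X$, let $\mathcal{O}_P$ be the local ring of $X$ at $P$, $\mathfrak{m}_P$ its maximal ideal and $k_P=\mathcal{O}_P/\mathfrak{m}_P$. The Zariski tangent space of $X/Y$ at $P$ is $T_P(X/Y):=\operatorname{Hom}_{k_P}(\Omega_{X/Y}\otimes_{\mathcal{O}_X}k_P,k_P)$, where $\Omega_{X/Y}$ is the sheaf of relative differentials (the tensor product being identified with its stalk at $P$). If $Y=\operatorname{Spec}(A)$ one writes $T_P(X/A)$. The embedding dimension is $\operatorname{edim}_P(X):=\dim_{k_P}(\mathfrak{m}_P/\mathfrak{m}_P^2)$. *)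

(* Defs.v *)
(* Complex numbers are represented by algC, the field over which MathComp
   develops character theory: irreducible complex characters take algebraic
   values, and complex roots of unity are algebraic. *)
From HB Require Import structures.
From mathcomp Require Import all_boot all_order all_algebra.
From mathcomp Require Import all_fingroup all_field all_character.
From mathcomp Require Import generic_quotient ring_quotient.
From mathcomp Require Import boolp functions finmap.
From mathcomp.multinomials Require Import monalg.
From mathcomp Require Import ring.

Set Implicit Arguments.
Unset Strict Implicit.
Unset Printing Implicit Defensive.

Import GRing.Theory.
Local Open Scope ring_scope.
Local Open Scope quotient_scope.

Section LmodQuotient.
Variables (R : pzRingType) (V : lmodType R) (S : submodClosed V).

Definition submod_pred : {pred V} := S.
Fact submod_pred_zmod : zmod_closed submod_pred.
Proof.
by split=> [|x y xS yS]; [exact: rpred0 | rewrite rpredD // -scaleN1r rpredZ].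
Qed.
HB.instance Definition _ := GRing.isZmodClosed.Build V submod_pred
  submod_pred_zmod.

Definition lmod_quot : Type := Quotient.quot submod_pred.

HB.instance Definition _ := GRing.Zmodule.on lmod_quot.

Definition lmod_pi (v : V) : lmod_quot := \pi_(Quotient.quot submod_pred) v.

Lemma lmod_pi_zmod : zmod_morphism lmod_pi.
Proof.
by move=> x y; rewrite /lmod_pi raddfB.
Qed.
HB.instance Definition _ := GRing.isZmodMorphism.Build V lmod_quot lmod_pi
  lmod_pi_zmod.

Definition lmod_repr (x : lmod_quot) : V :=
  repr (x : Quotient.quot submod_pred).

Lemma lmod_reprK : cancel lmod_repr lmod_pi.
Proof.
by move=> x; rewrite /lmod_pi reprK.
Qed.

Lemma lmod_piP u v : (lmod_pi u == lmod_pi v) = (u - v \in S).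
Proof.
by rewrite -[RHS]/(u - v \in submod_pred) Quotient.idealrBE.
Qed.

Definition lmod_quot_scale (a : R) (x : lmod_quot) : lmod_quot :=
  lmod_pi (a *: lmod_repr x).

Lemma lmod_quot_scale_pi a v : lmod_quot_scale a (lmod_pi v) = lmod_pi (a *: v).
Proof.
apply/eqP; rewrite lmod_piP -scalerBr rpredZ // -lmod_piP.
by rewrite lmod_reprK.
Qed.

Fact lmod_quot_scaleA a b x :
  lmod_quot_scale a (lmod_quot_scale b x) = lmod_quot_scale (a * b) x.
Proof. by rewrite -[x]lmod_reprK !lmod_quot_scale_pi scalerA. Qed.
Fact lmod_quot_scale1 : left_id 1 lmod_quot_scale.
Proof. by move=> x; rewrite -[x]lmod_reprK lmod_quot_scale_pi scale1r. Qed.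
Fact lmod_quot_scaleDr : right_distributive lmod_quot_scale +%R.
Proof.
move=> a x y; rewrite -[x]lmod_reprK -[y]lmod_reprK -raddfD.
by rewrite !lmod_quot_scale_pi scalerDr raddfD.
Qed.
Fact lmod_quot_scaleDl x : {morph lmod_quot_scale^~ x : a b / a + b}.
Proof.
move=> a b; rewrite -[x]lmod_reprK !lmod_quot_scale_pi scalerDl.
by rewrite raddfD.
Qed.
HB.instance Definition _ := GRing.Zmodule_isLmodule.Build R lmod_quot
  lmod_quot_scaleA lmod_quot_scale1 lmod_quot_scaleDr lmod_quot_scaleDl.

Lemma lmod_piZ : scalable lmod_pi.
Proof. by move=> a v; rewrite -lmod_quot_scale_pi. Qed.
HB.instance Definition _ := GRing.isScalable.Build R V lmod_quot *:%R lmod_pi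
  lmod_piZ.

End LmodQuotient.

Section GeneratedSubmodule.
Variables (R : pzRingType) (V : lmodType R) (E : V -> Prop).

(* The intersection of the submodules containing E. *)
Definition gen_submod : {pred V} := fun v =>
  `[< forall S : {pred V}, submod_closed S -> (forall e, E e -> e \in S) ->
      v \in S >].

Fact gen_submod_closed : submod_closed gen_submod.
Proof.
split=> [|a u v /asboolP uE /asboolP vE]; apply/asboolP => S clS ES.
  by case: clS.
by case: (clS) => _; apply; [exact: uE | exact: vE].
Qed.
HB.instance Definition _ := GRing.isSubmodClosed.Build R V gen_submod
  gen_submod_closed.

Lemma mem_gen_submod e : E e -> e \in gen_submod.
Proof. by move=> Ee; apply/asboolP => S _; apply. Qed.

End GeneratedSubmodule.

Section FreeLift.
Variables (R : nzRingType) (K : choiceType) (W : lmodType R).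

(* The linear map from the free module {malg R[K]} extending f : K -> W. *)
Definition mlift (f : K -> W) (g : {malg R[K]}) : W :=
  \sum_(k <- msupp g) g@_k *: f k.

Lemma mliftw (f : K -> W) (d : {fset K}) (g : {malg R[K]}) :
  fsubset (msupp g) d -> mlift f g = \sum_(k <- d) g@_k *: f k.
Proof.
move=> gd; rewrite /mlift (big_fset_incl _ gd) // => k _ kg.
by rewrite mcoeff_outdom ?scale0r.
Qed.

Lemma mlift_is_linear f : linear (mlift f).
Proof.
move=> a u v; pose d := fsetU (msupp u) (msupp v).
have ud : fsubset (msupp u) d by apply: fsubsetUl.
have vd : fsubset (msupp v) d by apply: fsubsetUr.
have wd : fsubset (msupp (a *: u + v)) d.
  apply: (fsubset_trans (msuppD_le _ _)).
  by apply: fsetUSS => //; apply: msuppZ_le.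
rewrite (mliftw f ud) (mliftw f vd) (mliftw f wd) scaler_sumr -big_split /=.
apply: eq_bigr => k _.
by rewrite mcoeffD mcoeffZ scalerDl scalerA.
Qed.
HB.instance Definition _ f := GRing.isLinear.Build R {malg R[K]} W *:%R
  (mlift f) (mlift_is_linear f).

Lemma mliftZ f a g : mlift f (a *: g) = a *: mlift f g.
Proof. exact: linearZ. Qed.

Lemma mliftU f k : mlift f << k >> = f k.
Proof.
by rewrite (mliftw f msuppU_le) big_seq_fset1 mcoeffUU scale1r.
Qed.

Lemma mlift_lin_dep (f h : K -> W) a g :
  commutative (@GRing.mul R) ->
  mlift (fun k => a *: f k + h k) g = a *: mlift f g + mlift h g.
Proof.
move=> mulC; rewrite /mlift scaler_sumr -big_split; apply: eq_bigr => k _ /=.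
by rewrite scalerDr !scalerA mulC.
Qed.

End FreeLift.

Section Tensor.
Variables (R : comNzRingType) (M N : lmodType R).

Inductive tensor_rel : {malg R[(M * N)%type]} -> Prop :=
| TensorDl m m' n :
    tensor_rel (<< ((m + m')%R, n) >> - << (m, n) >> - << (m', n) >>)
| TensorDr m n n' :
    tensor_rel (<< (m, (n + n')%R) >> - << (m, n) >> - << (m, n') >>)
| TensorZl a m n : tensor_rel (<< (a *: m, n) >> - a *: << (m, n) >>)
| TensorZr a m n : tensor_rel (<< (m, a *: n) >> - a *: << (m, n) >>).

Definition tensor : Type := lmod_quot (gen_submod tensor_rel).
HB.instance Definition _ := GRing.Lmodule.on tensor.

Definition tens (m : M) (n : N) : tensor :=
  lmod_pi (gen_submod tensor_rel) << (m, n) >>.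

Lemma tens_rel0 w : tensor_rel w -> lmod_pi (gen_submod tensor_rel) w = 0.
Proof.
move=> wrel; rewrite -(raddf0 (lmod_pi (gen_submod tensor_rel))).
by apply/eqP; rewrite lmod_piP subr0 mem_gen_submod.
Qed.

Lemma tensDl m m' n : tens (m + m') n = tens m n + tens m' n.
Proof.
have /tens_rel0/eqP := TensorDl m m' n.
by rewrite !raddfB /= -addrA -opprD subr_eq0 => /eqP.
Qed.

Lemma tensDr m n n' : tens m (n + n') = tens m n + tens m n'.
Proof.
have /tens_rel0/eqP := TensorDr m n n'.
by rewrite !raddfB /= -addrA -opprD subr_eq0 => /eqP.
Qed.

Lemma tensZl a m n : tens (a *: m) n = a *: tens m n.
Proof.
have /tens_rel0/eqP := TensorZl a m n.
by rewrite raddfB /= lmod_piZ subr_eq0 => /eqP.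
Qed.

Lemma tensZr a m n : tens m (a *: n) = a *: tens m n.
Proof.
have /tens_rel0/eqP := TensorZr a m n.
by rewrite raddfB /= lmod_piZ subr_eq0 => /eqP.
Qed.

Lemma tens_ind (T : tensor -> Prop) :
  (forall m n, T (tens m n)) -> (forall x y, T x -> T y -> T (x + y)) ->
  forall x, T x.
Proof.
move=> Tt TD x; rewrite -[x]lmod_reprK; move: (lmod_repr x) => g.
have T0 : T 0 by rewrite -(scale0r (tens 0 0)) -tensZl.
rewrite [g]monalgE raddf_sum; elim/big_ind: _ => //= -[m n] _.
suff -> : << g@_(m, n) *g (m, n) >> = g@_(m, n) *: << (m, n) >>.
  by rewrite lmod_piZ -/(tens m n) -tensZl.
by apply/malgP => k; rewrite mcoeffZ !mcoeffU mulrnAr mulr1.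
Qed.

Variable W : lmodType R.

Definition bilin (b : M -> N -> W) :=
  (forall n, linear (b^~ n)) /\ (forall m, linear (b m)).

(* The map on M (x) N induced by b, meaningful when b is bilinear; it is
   locked to keep unification from unfolding it. *)
Definition tlift (b : M -> N -> W) (x : tensor) : W :=
  locked (mlift (fun mn => b mn.1 mn.2) (lmod_repr x)).

Lemma tlift_pi b : bilin b -> forall g : {malg R[(M * N)%type]},
  tlift b (lmod_pi _ g) = mlift (fun mn => b mn.1 mn.2) g.
Proof.
move=> [bl br] g; apply/eqP; rewrite /tlift -lock -subr_eq0 -raddfB.
have : lmod_repr (lmod_pi (gen_submod tensor_rel) g) - g
         \in gen_submod tensor_rel.
  by rewrite -lmod_piP lmod_reprK.
have b0l n : b 0 n = 0.
  by have := bl n (-1) 0 0; rewrite scaler0 addr0 scaleN1r addNr.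
have b0r m : b m 0 = 0.
  by have := br m (-1) 0 0; rewrite scaler0 addr0 scaleN1r addNr.
set w := (X in X \in _); move=> /asboolP
  /(_ (fun w => mlift (fun mn => b mn.1 mn.2) w == 0)); apply.
  split=> [|a u v /eqP u0 /eqP v0]; rewrite ?inE; apply/eqP.
    exact: raddf0.
  by rewrite linearP /= u0 v0 scaler0 addr0.
move=> _ [m m' n|m n n'|a m n|a m n]; apply/eqP.
- rewrite !raddfB /= !mliftU /=; have := bl n 1 m m'; rewrite !scale1r => ->.
  by rewrite addrAC addrK subrr.
- rewrite !raddfB /= !mliftU /=; have := br m 1 n n'; rewrite !scale1r => ->.
  by rewrite addrAC addrK subrr.
- rewrite raddfB /= mliftZ !mliftU /=; have := bl n a m 0.
  by rewrite !addr0 b0l addr0 => ->; rewrite subrr.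
- rewrite raddfB /= mliftZ !mliftU /=; have := br m a n 0.
  by rewrite !addr0 b0r addr0 => ->; rewrite subrr.
Qed.

Lemma tlift_tens b : bilin b -> forall m n, tlift b (tens m n) = b m n.
Proof. by move=> bb m n; rewrite tlift_pi // mliftU. Qed.

Lemma tlift_linear b : bilin b -> linear (tlift b).
Proof.
move=> bb a x y; rewrite -[x]lmod_reprK -[y]lmod_reprK -linearP.
by rewrite !tlift_pi // linearP.
Qed.

Lemma tlift_lin_dep (b c : M -> N -> W) a x :
  tlift (fun m n => a *: b m n + c m n) x = a *: tlift b x + tlift c x.
Proof. by rewrite /tlift -!lock -mlift_lin_dep //; exact: mulrC. Qed.

Lemma eq_tlift (b c : M -> N -> W) : b =2 c -> tlift b =1 tlift c.
Proof. by move=> bc x; rewrite /tlift -!lock; apply: eq_bigr => k _; rewrite bc. Qed.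

End Tensor.

Lemma int_linear (U V : lmodType int) (f : U -> V) :
  {morph f : x y / x + y} -> linear f.
Proof.
move=> fD; have f0 : f 0 = 0 by apply: (addIr (f 0)); rewrite -fD !add0r.
have fN : zmod_morphism f.
  move=> x y; apply: (addIr (f y)); rewrite -fD !addrNK //.
pose g : {additive U -> V} := HB.pack f (GRing.isZmodMorphism.Build U V f fN).
move=> a x y; rewrite fD; congr (_ + _).
by rewrite -[a]intz !scaler_int; exact: (raddfMz g).
Qed.

Section TensorMulTheory.
Variables (A B : comPzRingType) (V : zmodType) (t : A -> B -> V).
Variable mul : V -> V -> V.
Hypothesis ind : forall T : V -> Prop, (forall a b, T (t a b)) ->
  (forall x y, T x -> T y -> T (x + y)) -> forall x, T x.
Hypothesis mulDl : left_distributive mul +%R.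
Hypothesis mulDr : right_distributive mul +%R.
Hypothesis mulE : forall a b a' b', mul (t a b) (t a' b') = t (a * a') (b * b').

Lemma tensor_mulC : commutative mul.
Proof.
move=> x z; elim/ind: x => [a b|x y IHx IHy]; last by rewrite mulDl mulDr IHx IHy.
elim/ind: z => [a' b'|x y IHx IHy]; last by rewrite mulDl mulDr IHx IHy.
by rewrite !mulE [a * _]mulrC [b * _]mulrC.
Qed.

Lemma tensor_mulA : associative mul.
Proof.
move=> x z w; elim/ind: x => [a b|x y IHx IHy]; last by rewrite !mulDl IHx IHy.
elim/ind: z => [a' b'|x y IHx IHy].
  elim/ind: w => [a2 b2|x y IHx IHy]; last by rewrite !mulDr IHx IHy.
  by rewrite !mulE !mulrA.
by rewrite mulDl !mulDr mulDl IHx IHy.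
Qed.

Lemma tensor_mul1 : left_id (t 1 1) mul.
Proof.
by elim/ind => [a b|x y IHx IHy]; rewrite ?mulE ?mul1r // mulDr IHx IHy.
Qed.

End TensorMulTheory.

Section TensorRing.
Variables A B : comPzRingType.

(* A (x)_Z B; zmodule A is the additive group of A as a module over int. *)
Definition tensor_ring : Type := tensor (zmodule A) (zmodule B).
HB.instance Definition _ := GRing.Zmodule.on tensor_ring.

Definition rtens (a : A) (b : B) : tensor_ring :=
  tens (a : zmodule A) (b : zmodule B).

Lemma rtensDl a a' b : rtens (a + a') b = rtens a b + rtens a' b.
Proof. exact: tensDl. Qed.
Lemma rtensDr a b b' : rtens a (b + b') = rtens a b + rtens a b'.
Proof. exact: tensDr. Qed.

Definition tensor_ring_one : tensor_ring := rtens 1 1.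

Definition pure_mul (a : A) (b : B) (y : tensor_ring) : tensor_ring :=
  tlift (fun (a' : zmodule A) (b' : zmodule B) =>
    rtens ((a : A) * (a' : A)) ((b : B) * (b' : B))) y.

Definition tensor_ring_mul (x y : tensor_ring) : tensor_ring :=
  tlift (fun (a : zmodule A) (b : zmodule B) => pure_mul a b y) x.

Let bilin_in (a : A) (b : B) :
  bilin (fun (a' : zmodule A) (b' : zmodule B) =>
    rtens (a * (a' : A)) (b * (b' : B))).
Proof.
split=> [b'|a']; apply: int_linear => x y.
  by rewrite [a * _]mulrDr rtensDl.
by rewrite [b * _]mulrDr rtensDr.
Qed.

Let bilin_out (y : tensor_ring) :
  bilin (fun (a : zmodule A) (b : zmodule B) => pure_mul a b y).
Proof.
split=> [b|a]; apply: int_linear => u v; rewrite -[X in _ = X + _]scale1r;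
  rewrite -tlift_lin_dep; apply: eq_tlift => a' b'; rewrite scale1r.
  by rewrite [(_ + _) * _]mulrDl rtensDl.
by rewrite [(_ + _) * _]mulrDl rtensDr.
Qed.

Local Notation "x ** y" := (tensor_ring_mul x y) (at level 40).

Lemma tensor_ring_mulE a b a' b' :
  rtens a b ** rtens a' b' = rtens (a * a') (b * b').
Proof.
rewrite /tensor_ring_mul (tlift_tens (bilin_out _)).
exact: (tlift_tens (bilin_in a b)).
Qed.

Fact tensor_ring_mulDl : left_distributive tensor_ring_mul +%R.
Proof.
move=> x x' y; have := tlift_linear (bilin_out y) 1 x x'.
by rewrite !scale1r.
Qed.

Lemma pure_mulDr a b y y' :
  pure_mul a b (y + y') = pure_mul a b y + pure_mul a b y'.
Proof.
by have := tlift_linear (bilin_in a b) 1 y y'; rewrite !scale1r.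
Qed.

Fact tensor_ring_mulDr : right_distributive tensor_ring_mul +%R.
Proof.
move=> x y y'; pose h z (a : zmodule A) (b : zmodule B) := pure_mul a b z.
have E : h (y + y') =2 (fun a b => 1 *: h y a b + h y' a b).
  by move=> a b; rewrite scale1r; exact: pure_mulDr.
have := tlift_lin_dep (h y) (h y') 1 x.
by rewrite -(eq_tlift E) scale1r.
Qed.

Lemma rtens_ind (T : tensor_ring -> Prop) :
  (forall a b, T (rtens a b)) -> (forall x y, T x -> T y -> T (x + y)) ->
  forall x, T x.
Proof. by move=> Tt TD; apply: (tens_ind _ TD) => m n; apply: Tt. Qed.

Fact tensor_ring_mulC : commutative tensor_ring_mul.
Proof.
exact: (tensor_mulC rtens_ind tensor_ring_mulDl tensor_ring_mulDr
  tensor_ring_mulE).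
Qed.

Fact tensor_ring_mulA : associative tensor_ring_mul.
Proof.
exact: (tensor_mulA rtens_ind tensor_ring_mulDl tensor_ring_mulDr
  tensor_ring_mulE).
Qed.

Fact tensor_ring_mul1 : left_id tensor_ring_one tensor_ring_mul.
Proof. exact: (tensor_mul1 rtens_ind tensor_ring_mulDr tensor_ring_mulE). Qed.

HB.instance Definition _ := GRing.Zmodule_isComPzRing.Build tensor_ring
  tensor_ring_mulA tensor_ring_mulC tensor_ring_mul1 tensor_ring_mulDl.

Definition tensor_inr (b : B) : tensor_ring := rtens 1 b.

Fact tensor_inr_zmod : zmod_morphism tensor_inr.
Proof.
by move=> x y; apply: (addIr (tensor_inr y)); rewrite /tensor_inr -rtensDr !addrNK.
Qed.
Fact tensor_inr_monoid : monoid_morphism tensor_inr.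
Proof.
by split=> // x y; rewrite [RHS]tensor_ring_mulE mulr1.
Qed.
HB.instance Definition _ := GRing.isZmodMorphism.Build B tensor_ring tensor_inr
  tensor_inr_zmod.
HB.instance Definition _ := GRing.isMonoidMorphism.Build B tensor_ring
  tensor_inr tensor_inr_monoid.

End TensorRing.

Section BaseChangeTheory.
Variables (S : comPzRingType) (M V : zmodType) (t : M -> S -> V).
Variable scale : S -> V -> V.
Hypothesis ind : forall T : V -> Prop, (forall m s, T (t m s)) ->
  (forall x y, T x -> T y -> T (x + y)) -> forall x, T x.
Hypothesis tDr : forall m s s', t m (s + s') = t m s + t m s'.
Hypothesis scaleDr : right_distributive scale +%R.
Hypothesis scaleE : forall s m s', scale s (t m s') = t m (s * s').

Lemma bc_scaleDl x : {morph scale^~ x : s s' / s + s'}.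
Proof.
elim/ind: x => [m u|x y IHx IHy] s s'; first by rewrite !scaleE mulrDl tDr.
by rewrite !scaleDr IHx IHy addrACA.
Qed.

Lemma bc_scaleA s s' x : scale s (scale s' x) = scale (s * s') x.
Proof.
elim/ind: x => [m u|x y IHx IHy]; first by rewrite !scaleE mulrA.
by rewrite !scaleDr IHx IHy.
Qed.

Lemma bc_scale1 : left_id 1 scale.
Proof.
by elim/ind => [m u|x y IHx IHy]; rewrite ?scaleE ?mul1r // scaleDr IHx IHy.
Qed.

End BaseChangeTheory.

Section BaseChange.
Variables (R : comNzRingType) (S : comPzRingType) (f : {rmorphism R -> S}).

(* S viewed as an R-module through f. *)
Definition restr : Type := S.
HB.instance Definition _ := GRing.Zmodule.on restr.

Definition restr_scale (a : R) (s : restr) : restr := f a * (s : S).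
Fact restr_scaleA a b s : restr_scale a (restr_scale b s) = restr_scale (a * b) s.
Proof. by rewrite /restr_scale rmorphM mulrA. Qed.
Fact restr_scale1 : left_id 1 restr_scale.
Proof. by move=> s; rewrite /restr_scale rmorph1 mul1r. Qed.
Fact restr_scaleDr : right_distributive restr_scale +%R.
Proof. by move=> a s t; rewrite /restr_scale [f a * _]mulrDr. Qed.
Fact restr_scaleDl s : {morph restr_scale^~ s : a b / a + b}.
Proof. by move=> a b; rewrite /restr_scale rmorphD [(_ + _) * _]mulrDl. Qed.
HB.instance Definition _ := GRing.Zmodule_isLmodule.Build R restr
  restr_scaleA restr_scale1 restr_scaleDr restr_scaleDl.

Variable M : lmodType R.

(* M (x)_R S as an S-module, acting through the right factor. *)
Definition base_change : Type := tensor M restr.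
HB.instance Definition _ := GRing.Zmodule.on base_change.

Definition btens (m : M) (s : S) : base_change := tens m (s : restr).

Definition base_change_scale (s : S) (x : base_change) : base_change :=
  tlift (fun (m : M) (t : restr) => btens m (s * (t : S))) x.

Lemma btensDr m s s' : btens m (s + s') = btens m s + btens m s'.
Proof. exact: tensDr. Qed.

Lemma btens_ind (T : base_change -> Prop) :
  (forall m s, T (btens m s)) -> (forall x y, T x -> T y -> T (x + y)) ->
  forall x, T x.
Proof. by move=> Tt TD; apply: (tens_ind _ TD) => m s; apply: Tt. Qed.

Let bilin_bc (s : S) :
  bilin (fun (m : M) (t : restr) => btens m (s * (t : S))).
Proof.
split=> [t|m] a u v; first by rewrite /btens tensDl tensZl.
rewrite [s * _]mulrDr btensDr; congr (_ + _).
by rewrite /btens -tensZr; congr tens; exact: mulrCA.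
Qed.

Fact base_change_scaleE s m t : base_change_scale s (btens m t) = btens m (s * t).
Proof. exact: (tlift_tens (bilin_bc s)). Qed.

Fact base_change_scaleDr : right_distributive base_change_scale +%R.
Proof.
by move=> s x y; have := tlift_linear (bilin_bc s) 1 x y; rewrite !scale1r.
Qed.

Definition base_change_scaleA :=
  bc_scaleA btens_ind base_change_scaleDr base_change_scaleE.
Definition base_change_scale1 :=
  bc_scale1 btens_ind base_change_scaleDr base_change_scaleE.
Definition base_change_scaleDl :=
  bc_scaleDl btens_ind btensDr base_change_scaleDr base_change_scaleE.
HB.instance Definition _ := GRing.Zmodule_isLmodule.Build S base_change
  base_change_scaleA base_change_scale1 base_change_scaleDr
  base_change_scaleDl.

End BaseChange.

Section Kaehler.
Variables (A : pzRingType) (B : comNzRingType) (f : {rmorphism A -> B}).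

(* Omega_{B/A}, on generators << x >> standing for the differentials dx. *)
Inductive kaehler_rel : {malg B[B]} -> Prop :=
| KaehlerD x y : kaehler_rel (<< (x + y)%R >> - << x >> - << y >>)
| KaehlerM x y : kaehler_rel (<< (x * y)%R >> - x *: << y >> - y *: << x >>)
| KaehlerC a : kaehler_rel << f a >>.

Definition kaehler : Type := lmod_quot (gen_submod kaehler_rel).
HB.instance Definition _ := GRing.Lmodule.on kaehler.

End Kaehler.

Section Localization.
Variables (A : comNzRingType) (P : prime_idealr A).

Definition denom : Type := {s : A | s \notin P}.
HB.instance Definition _ := SubChoice.on denom.
Definition dval (s : denom) : A := sval s.
Arguments dval : simpl never.

Fact dvalP (s : denom) : dval s \notin P. Proof. exact: (svalP s). Qed.

Fact denom1_subproof : 1 \notin P. Proof. by rewrite idealr1. Qed.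
Definition denom1 : denom := exist (fun s => s \notin P) 1 denom1_subproof.

Fact denomM_subproof (s t : denom) : dval s * dval t \notin P.
Proof. by rewrite prime_idealrM negb_or !dvalP. Qed.
Definition denomM (s t : denom) : denom :=
  exist (fun s => s \notin P) _ (denomM_subproof s t).

Fact dval1 : dval denom1 = 1. Proof. by []. Qed.
Fact dvalM s t : dval (denomM s t) = dval s * dval t. Proof. by []. Qed.

Definition loc_eq (x y : A * denom) : bool :=
  `[< exists u : denom, dval u * (x.1 * dval y.2 - y.1 * dval x.2) = 0 >].

Lemma loc_eqP x y :
  reflect (exists u : denom, dval u * (x.1 * dval y.2) = dval u * (y.1 * dval x.2))
    (loc_eq x y).
Proof.
rewrite /loc_eq; apply: (iffP (asboolP _)) => -[u /eqP].
  by rewrite mulrBr subr_eq0 => /eqP; exists u.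
by rewrite -subr_eq0 -mulrBr => /eqP; exists u.
Qed.

Fact loc_eq_equiv : equiv_class_of loc_eq.
Proof.
split=> [x|x y|y x z].
- by apply/loc_eqP; exists denom1.
- by apply/loc_eqP/loc_eqP => -[u E]; exists u; rewrite E.
- move=> /loc_eqP[u E] /loc_eqP[v F]; apply/loc_eqP.
  exists (denomM (denomM u v) y.2); rewrite !dvalM.
  have -> : dval u * dval v * dval y.2 * (x.1 * dval z.2)
          = dval u * (x.1 * dval y.2) * (dval v * dval z.2) by ring.
  rewrite E.
  have -> : dval u * (y.1 * dval x.2) * (dval v * dval z.2)
          = dval u * dval x.2 * (dval v * (y.1 * dval z.2)) by ring.
  by rewrite F; ring.
Qed.
Canonical loc_eq_equivRel := EquivRelPack loc_eq_equiv.

(* The local ring A_P. *)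
Definition localization : Type := {eq_quot loc_eq}.
HB.instance Definition _ := Choice.on localization.
HB.instance Definition _ := EqQuotient.on localization.

Definition frac (a : A) (s : denom) : localization := \pi_localization (a, s).

Lemma fracP a s b t : reflect
  (exists u : denom, dval u * (a * dval t) = dval u * (b * dval s))
  (frac a s == frac b t).
Proof. by rewrite /frac eqmodE; apply: (iffP (loc_eqP _ _)). Qed.

Definition num (x : localization) : A := (repr x).1.
Definition den (x : localization) : denom := (repr x).2.
Lemma fracK (x : localization) : frac (num x) (den x) = x.
Proof. by rewrite /frac /num /den -surjective_pairing reprK. Qed.

Definition loc_add (x y : localization) : localization :=
  frac (num x * dval (den y) + num y * dval (den x)) (denomM (den x) (den y)).
Definition loc_opp (x : localization) : localization := frac (- num x) (den x).
Definition loc_mul (x y : localization) : localization :=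
  frac (num x * num y) (denomM (den x) (den y)).

Lemma loc_addE a s b t :
  loc_add (frac a s) (frac b t)
  = frac (a * dval t + b * dval s) (denomM s t).
Proof.
have /eqP/fracP[u E] := fracK (frac a s).
have /eqP/fracP[v F] := fracK (frac b t).
apply/eqP/fracP; exists (denomM u v); rewrite !dvalM.
set a' := num _ in E *; set s' := den _ in E *.
set b' := num _ in F *; set t' := den _ in F *.
have -> : dval u * dval v * ((a' * dval t' + b' * dval s') * (dval s * dval t))
  = dval u * (a' * dval s) * (dval v * dval t * dval t')
    + dval v * (b' * dval t) * (dval u * dval s' * dval s) by ring.
by rewrite E F; ring.
Qed.

Lemma loc_oppE a s : loc_opp (frac a s) = frac (- a) s.
Proof.
have /eqP/fracP[u E] := fracK (frac a s).
by apply/eqP/fracP; exists u; rewrite !mulNr !mulrN E.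
Qed.

Lemma loc_mulE a s b t :
  loc_mul (frac a s) (frac b t) = frac (a * b) (denomM s t).
Proof.
have /eqP/fracP[u E] := fracK (frac a s).
have /eqP/fracP[v F] := fracK (frac b t).
apply/eqP/fracP; exists (denomM u v); rewrite !dvalM.
set a' := num _ in E *; set s' := den _ in E *.
set b' := num _ in F *; set t' := den _ in F *.
have -> : dval u * dval v * (a' * b' * (dval s * dval t))
  = dval u * (a' * dval s) * (dval v * (b' * dval t)) by ring.
by rewrite E F; ring.
Qed.

Lemma frac_ind (T : localization -> Prop) :
  (forall a s, T (frac a s)) -> forall x, T x.
Proof. by move=> Tf x; rewrite -[x]fracK. Qed.

Lemma frac_eq a s b t : a * dval t = b * dval s -> frac a s = frac b t.
Proof. by move=> E; apply/eqP/fracP; exists denom1; rewrite E. Qed.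

Fact loc_addA : associative loc_add.
Proof.
elim/frac_ind=> a s; elim/frac_ind=> b t; elim/frac_ind=> c u.
by rewrite !loc_addE; apply: frac_eq; rewrite ?dvalM ?dval1; ring.
Qed.
Fact loc_addC : commutative loc_add.
Proof.
elim/frac_ind=> a s; elim/frac_ind=> b t.
by rewrite !loc_addE; apply: frac_eq; rewrite ?dvalM ?dval1; ring.
Qed.
Fact loc_add0 : left_id (frac 0 denom1) loc_add.
Proof.
by elim/frac_ind=> a s; rewrite !loc_addE; apply: frac_eq; rewrite ?dvalM ?dval1; ring.
Qed.
Fact loc_addN : left_inverse (frac 0 denom1) loc_opp loc_add.
Proof.
elim/frac_ind=> a s; rewrite loc_oppE !loc_addE.
by apply: frac_eq; rewrite ?dvalM ?dval1; ring.
Qed.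
HB.instance Definition _ := GRing.isZmodule.Build localization
  loc_addA loc_addC loc_add0 loc_addN.

Fact loc_mulA : associative loc_mul.
Proof.
elim/frac_ind=> a s; elim/frac_ind=> b t; elim/frac_ind=> c u.
by rewrite !loc_mulE; apply: frac_eq; rewrite ?dvalM ?dval1; ring.
Qed.
Fact loc_mulC : commutative loc_mul.
Proof.
elim/frac_ind=> a s; elim/frac_ind=> b t.
by rewrite !loc_mulE; apply: frac_eq; rewrite ?dvalM ?dval1; ring.
Qed.
Fact loc_mul1 : left_id (frac 1 denom1) loc_mul.
Proof.
by elim/frac_ind=> a s; rewrite !loc_mulE; apply: frac_eq; rewrite ?dvalM ?dval1; ring.
Qed.
Fact loc_mulDl : left_distributive loc_mul loc_add.
Proof.
elim/frac_ind=> a s; elim/frac_ind=> b t; elim/frac_ind=> c u.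
by rewrite !(loc_addE, loc_mulE); apply: frac_eq; rewrite ?dvalM ?dval1; ring.
Qed.
Fact loc_1neq0 : frac 1 denom1 != frac 0 denom1.
Proof.
apply/fracP=> -[u]; rewrite dval1 mul0r mulr0 !mulr1 => u0.
by have := dvalP u; rewrite u0 rpred0.
Qed.
HB.instance Definition _ := GRing.Zmodule_isComNzRing.Build localization
  loc_mulA loc_mulC loc_mul1 loc_mulDl loc_1neq0.

Lemma fracD a s b t :
  frac a s + frac b t = frac (a * dval t + b * dval s) (denomM s t).
Proof. exact: loc_addE. Qed.
Lemma fracN a s : - frac a s = frac (- a) s.
Proof. exact: loc_oppE. Qed.
Lemma fracM a s b t : frac a s * frac b t = frac (a * b) (denomM s t).
Proof. exact: loc_mulE. Qed.

Definition loc_map (a : A) : localization := frac a denom1.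
Fact loc_map_zmod : zmod_morphism loc_map.
Proof.
by move=> a b; rewrite /loc_map fracN fracD; apply: frac_eq; rewrite ?dvalM ?dval1; ring.
Qed.
Fact loc_map_monoid : monoid_morphism loc_map.
Proof.
by split=> // a b; rewrite /loc_map fracM; apply: frac_eq; rewrite ?dvalM ?dval1; ring.
Qed.
HB.instance Definition _ := GRing.isZmodMorphism.Build A localization loc_map
  loc_map_zmod.
HB.instance Definition _ := GRing.isMonoidMorphism.Build A localization loc_map
  loc_map_monoid.

(* The maximal ideal P A_P of A_P. *)
Definition loc_max : {pred localization} := fun x =>
  `[< exists a s, a \in P /\ x = frac a s >].

Lemma frac_max a s : (frac a s \in loc_max) = (a \in P).
Proof.
apply/asboolP/idP => [[b [t [bP /eqP/fracP[u E]]]]|aP]; last by exists a, s.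
have : dval u * (a * dval t) \in P by rewrite E mulrCA mulrC idealMr // mulrC idealMr.
by rewrite !prime_idealrM !(negbTE (dvalP _)) orbF.
Qed.

Fact loc_max_ideal : idealr_closed loc_max.
Proof.
split; rewrite ?frac_max ?idealr0 ?idealr1 //.
move=> x y z; elim/frac_ind: x => a s; elim/frac_ind: y => b t.
elim/frac_ind: z => c u; rewrite fracM fracD !frac_max => bP cP.
by rewrite rpredD // mulrC !idealMr.
Qed.
HB.instance Definition _ := isIdealr.Build localization loc_max loc_max_ideal.

Definition residue : Type := {ideal_quot loc_max}.
HB.instance Definition _ := GRing.ComNzRing.on residue.

Definition residue_map (x : localization) : residue :=
  \pi_{ideal_quot loc_max} x.
Fact residue_map_zmod : zmod_morphism residue_map.
Proof. by move=> x y; rewrite /residue_map raddfB. Qed.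
Fact residue_map_monoid : monoid_morphism residue_map.
Proof. by split=> [|x y]; rewrite /residue_map ?rmorph1 ?rmorphM. Qed.
HB.instance Definition _ := GRing.isZmodMorphism.Build localization residue
  residue_map residue_map_zmod.
HB.instance Definition _ := GRing.isMonoidMorphism.Build localization residue
  residue_map residue_map_monoid.

Lemma residue_map_eq0 x : (residue_map x == 0) = (x \in loc_max).
Proof.
rewrite -(rmorph0 residue_map) /residue_map -Quotient.idealrBE subr0 //.
Qed.

Lemma residue_map_repr (c : residue) :
  residue_map (repr (c : {ideal_quot loc_max})) = c.
Proof. by rewrite /residue_map reprK. Qed.

Lemma residue_invP (c : residue) :
  exists d : residue, if c == 0 then d = 0 else d * c = 1.
Proof.
rewrite -[c]residue_map_repr; move: (repr _) => x; elim/frac_ind: x => a s.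
rewrite residue_map_eq0 frac_max.
have [aP|aP] := boolP (a \in P); first by exists 0.
pose t : denom := exist (fun s => s \notin P) a aP.
have tE : dval t = a by [].
exists (residue_map (frac (dval s) t)).
rewrite -rmorphM fracM -(rmorph1 residue_map); congr residue_map.
by apply: frac_eq; rewrite !dvalM dval1 tE; ring.
Qed.

Definition residue_inv (c : residue) : residue := projT1 (cid (residue_invP c)).
Fact residue_mulV c : c != 0 -> residue_inv c * c = 1.
Proof.
by rewrite /residue_inv; case: cid => d /= + /negbTE c0; rewrite c0.
Qed.
Fact residue_inv0 : residue_inv 0 = 0.
Proof. by rewrite /residue_inv; case: cid => d /=; rewrite eqxx. Qed.
HB.instance Definition _ := GRing.ComNzRing_isField.Build residue
  residue_mulV residue_inv0.

End Localization.
Arguments loc_map [A] P a.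
Arguments loc_max [A] P x.
Arguments residue_map [A] P x.

Section ResidueModuleTheory.
Variables (R K : pzRingType) (f : {rmorphism R -> K}) (g : K -> R).
Variable V : lmodType R.
Hypotheses (gK : cancel g f) (fV : forall a (v : V), f a = 0 -> a *: v = 0).

Lemma residue_scaleP a b (v : V) : f a = f b -> a *: v = b *: v.
Proof.
move=> fab; apply/eqP; rewrite -subr_eq0 -scalerBl fV //.
by rewrite rmorphB fab subrr.
Qed.

Lemma residue_scaleA c d (v : V) : g c *: (g d *: v) = g (c * d) *: v.
Proof. by rewrite scalerA; apply: residue_scaleP; rewrite rmorphM !gK. Qed.
Lemma residue_scale1 : left_id 1 (fun c (v : V) => g c *: v).
Proof.
move=> v; rewrite -[RHS]scale1r; apply: residue_scaleP.
by rewrite rmorph1 gK.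
Qed.
Lemma residue_scaleDr : right_distributive (fun c (v : V) => g c *: v) +%R.
Proof. by move=> c u v; rewrite scalerDr. Qed.
Lemma residue_scaleDl (v : V) : {morph (fun c => g c *: v) : c d / c + d}.
Proof.
by move=> c d; rewrite -scalerDl; apply: residue_scaleP; rewrite rmorphD !gK.
Qed.

End ResidueModuleTheory.

(* The square of an ideal I: the ideal generated by the products of two
   elements of I. *)
Definition ideal_sq (A : comPzRingType) (I : {pred A}) : {pred A^o} :=
  gen_submod (fun z : A^o => exists x y, [/\ x \in I, y \in I & z = x * y]).

Section Cotangent.
Variables (A : comNzRingType) (P : prime_idealr A).
Local Notation O := (localization P).

Definition loc_max_pred : {pred O^o} := loc_max P.
Fact loc_max_pred_closed : submod_closed loc_max_pred.
Proof.
split=> [|a x y xm ym]; rewrite /loc_max_pred; first exact: idealr0.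
by apply: rpredD => //; apply: idealMr.
Qed.
HB.instance Definition _ := GRing.isSubmodClosed.Build O O^o loc_max_pred
  loc_max_pred_closed.

Definition loc_max_mod : Type := {x : O^o | x \in loc_max_pred}.
HB.instance Definition _ := [isSub of loc_max_mod for @sval _ _].
HB.instance Definition _ := [Choice of loc_max_mod by <:].
HB.instance Definition _ := [SubChoice_isSubLmodule of loc_max_mod by <:].

Definition loc_max_sq : {pred loc_max_mod} :=
  fun x => val x \in ideal_sq (loc_max P).
Fact loc_max_sq_closed : submod_closed loc_max_sq.
Proof.
have E (x : loc_max_mod) :
  (x \in loc_max_sq) = (val x \in ideal_sq (loc_max P)) by [].
split=> [|a x y]; rewrite !E ?raddf0 ?rpred0 // linearP => xm ym.
by rewrite rpredD // rpredZ.
Qed.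
HB.instance Definition _ := GRing.isSubmodClosed.Build O loc_max_mod loc_max_sq
  loc_max_sq_closed.

Local Notation V := (lmod_quot loc_max_sq).

Fact residue_actV a (v : V) : residue_map P a = 0 -> a *: v = 0.
Proof.
move=> /eqP; rewrite residue_map_eq0 => am.
rewrite -[v]lmod_reprK -lmod_piZ -(raddf0 (lmod_pi loc_max_sq)).
apply/eqP; rewrite lmod_piP subr0; apply: mem_gen_submod.
by exists a, (val (lmod_repr v)); split=> //; exact: (svalP (lmod_repr v)).
Qed.

(* m_P / m_P^2, an O_P-module killed by m_P, as a vector space over k_P. *)
Definition cotangent : Type := V.
HB.instance Definition _ := GRing.Zmodule.on cotangent.

Definition residue_repr (c : residue P) : O :=
  repr (c : {ideal_quot (loc_max P)}).
Fact residue_reprK : cancel residue_repr (residue_map P).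
Proof. exact: residue_map_repr. Qed.

Definition cotangent_scale (c : residue P) (v : cotangent) : cotangent :=
  residue_repr c *: (v : V).

HB.instance Definition _ := GRing.Zmodule_isLmodule.Build (residue P) cotangent
  (residue_scaleA residue_reprK residue_actV)
  (residue_scale1 residue_reprK residue_actV)
  (@residue_scaleDr _ _ residue_repr V)
  (residue_scaleDl residue_reprK residue_actV).

End Cotangent.

Section Dual.
Variables (k : comPzRingType) (V : lmodType k).

Definition linear_form : {pred V -> k^o} := fun f => `[< linear f >].
Fact linear_form_closed : submod_closed linear_form.
Proof.
split=> [|a f g /asboolP fl /asboolP gl]; apply/asboolP => b u v.
  by rewrite scaler0 addr0.
have E h : (a *: f + g) h = a *: f h + g h by [].
by rewrite !E fl gl !scalerDr !scalerA mulrC addrACA.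
Qed.
HB.instance Definition _ := GRing.isSubmodClosed.Build k (V -> k^o) linear_form
  linear_form_closed.

(* Hom_k(V, k) with its pointwise k-module structure. *)
Definition dual : Type := {f : V -> k^o | f \in linear_form}.
HB.instance Definition _ := [isSub of dual for @sval _ _].
HB.instance Definition _ := [Choice of dual by <:].
HB.instance Definition _ := [SubChoice_isSubLmodule of dual by <:].

End Dual.

(* V has a basis of d vectors over k. *)
Definition has_dim (k : fieldType) (V : lmodType k) (d : nat) : Prop :=
  exists e : 'I_d -> V,
    forall v, exists! c : {ffun 'I_d -> k}, v = \sum_(i < d) c i *: e i.

Section Tangent.
Variables (B : pzRingType) (A : comNzRingType) (f : {rmorphism B -> A}).
Variable P : prime_idealr A.

Definition stalk_map (b : B) : localization P := loc_map P (f b).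
Fact stalk_map_zmod : zmod_morphism stalk_map.
Proof. by move=> x y; rewrite /stalk_map !rmorphB. Qed.
Fact stalk_map_monoid : monoid_morphism stalk_map.
Proof. by split=> [|x y]; rewrite /stalk_map ?rmorph1 ?rmorphM. Qed.
HB.instance Definition _ := GRing.isZmodMorphism.Build B (localization P)
  stalk_map stalk_map_zmod.
HB.instance Definition _ := GRing.isMonoidMorphism.Build B (localization P)
  stalk_map stalk_map_monoid.

(* T_P(X/Y) for X = Spec A, Y = Spec B and the morphism X -> Y given by f.  The
   stalk of Omega_{X/Y} at P is the module of differentials of O_P over B. *)
Definition tangent : lmodType (residue P) :=
  dual (base_change (residue_map P) (kaehler stalk_map)).

End Tangent.

(* A point P of Spec A is closed when {P} is the set V(E) of the primes
   containing some subset E of A. *)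
Definition closed_point (A : comNzRingType) (P : prime_idealr A) : Prop :=
  exists E : A -> Prop, forall Q : prime_idealr A,
    (forall x, E x -> x \in Q) <-> Q =i P.

Section RepresentationRing.
Variables (gT : finGroupType) (G : {group gT}).

Definition rep_ring : Type := {phi : 'CF(G) | phi \in 'Z[irr G]%g}.
HB.instance Definition _ := [isSub of rep_ring for @sval _ _].
HB.instance Definition _ := [Choice of rep_ring by <:].
HB.instance Definition _ := [SubChoice_isSubComNzRing of rep_ring by <:].

End RepresentationRing.

Section IntegerAdjunction.
Variable x : algC.

(* Z[x], as the set of values at x of integer polynomials. *)
Definition int_adjoin_pred : {pred algC} := fun z =>
  `[< exists q : {poly int}, z = (map_poly intr q).[x] >].
Fact int_adjoin_closed : subring_closed int_adjoin_pred.
Proof.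
split=> [|_ _ /asboolP[q ->] /asboolP[r ->]|_ _ /asboolP[q ->] /asboolP[r ->]];
  apply/asboolP.
- by exists 1; rewrite rmorph1 hornerC.
- by exists (q - r); rewrite rmorphB hornerD hornerN.
- by exists (q * r); rewrite rmorphM hornerM.
Qed.
HB.instance Definition _ := GRing.isSubringClosed.Build algC int_adjoin_pred
  int_adjoin_closed.

Definition int_adjoin : Type := {z : algC | z \in int_adjoin_pred}.
HB.instance Definition _ := [isSub of int_adjoin for @sval _ _].
HB.instance Definition _ := [Choice of int_adjoin by <:].
HB.instance Definition _ := [SubChoice_isSubComNzRing of int_adjoin by <:].

End IntegerAdjunction.

Section RepresentationRingTensor.
Variables (gT : finGroupType) (G : {group gT}) (xi : algC).

(* R(G) (x)_Z Z[xi]. *)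
Definition rep_ring_xi : Type := tensor_ring (rep_ring G) (int_adjoin xi).
HB.instance Definition _ := GRing.ComPzRing.on rep_ring_xi.

Fact rep_ring_xi_1neq0 : (1 : rep_ring_xi) != 0.
Proof.
pose b (phi : zmodule (rep_ring G)) (z : zmodule (int_adjoin xi)) : zmodule algC
  := (val (phi : rep_ring G) : 'CF(G)) 1%g * val (z : int_adjoin xi).
have bb : bilin b.
  split=> [z|phi]; apply: int_linear => u v; rewrite /b.
    by rewrite raddfD /= cfunE mulrDl.
  by rewrite raddfD mulrDr.
apply/eqP => E; have := tlift_linear bb (-1) 0 0.
rewrite scaler0 addr0 scaleN1r addNr -[X in tlift b X]E.
rewrite (tlift_tens bb) /b /= cfun1E group1 mulr1.
by move/eqP; rewrite oner_eq0.
Qed.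
HB.instance Definition _ := GRing.PzSemiRing_isNonZero.Build rep_ring_xi
  rep_ring_xi_1neq0.

(* The structure map Z[xi] -> R(G) (x)_Z Z[xi]. *)
Definition rep_ring_xi_in : int_adjoin xi -> rep_ring_xi :=
  @tensor_inr (rep_ring G) (int_adjoin xi).
HB.instance Definition _ := GRing.RMorphism.on rep_ring_xi_in.

End RepresentationRingTensor.

Arguments rep_ring_xi [gT] G xi.
Arguments rep_ring_xi_in [gT] G xi z.

(* Main.v *)
From HB Require Import structures.
From mathcomp Require Import all_boot all_order all_algebra.
From mathcomp Require Import all_fingroup all_field all_character.
From mathcomp Require Import generic_quotient ring_quotient boolp finmap.
From mathcomp Require Import cyclic.
From mathcomp.multinomials Require Import monalg.
Require Import Defs.
From mathcomp Require Import ring.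

Set Implicit Arguments.
Unset Strict Implicit.
Unset Printing Implicit Defensive.

Import GRing.Theory Num.Theory.
Local Open Scope ring_scope.

(** Let [Z = Z[xi]] and [A = R(G) (x) Z]. Evaluation of characters at an element
    of [G] is a [Z]-algebra map [A -> Z], and an element of [A] killed by all
    evaluations is zero; so every prime [P] contains the kernel of one of them,
    [eps] (Lemma [exists_evaluation_mod]). Hence [A = Z + P], and the point is
    governed by the prime [pp] of [Z] below it.

    The arithmetic of [Z] enters through one element [d] (Lemma
    [exists_uniformizer]): [d = p] in case (ii), and [d = 1 - xi ^ m] with [m]
    the prime-to-[p] part of [n] in case (i). It divides [p], its square divides
    [p] in case (i), and for some power [q > 1] of [p] it divides [z - z ^ q] for
    all [z] in [Z]. As [z ^ q] is in [pp ^ 2] for [z] in [pp], the element [d]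
    generates [pp] modulo [pp ^ 2]. It is not in [pp ^ 2]: each [z] in [pp]
    becomes a multiple of [d] after multiplication by [1 - z ^ (q - 1)], which is
    outside [pp], so from [d] in [pp ^ 2] one could cancel [d] and get an element
    outside [pp] that is divisible by [d], although [d] is in [pp]. Applying
    [eps], [d] is not in [P ^ 2] either (Lemma [d_notin_sq]); therefore [p] lies
    in [P ^ 2] exactly in case (i).

    Every [a] in the local ring at [P] is congruent to [a ^ q] modulo the maximal
    ideal. A derivation [D] into [k_P] kills [a ^ q], so [D a = D (a - a ^ q)] is
    determined by the linear form that [D] induces on the cotangent space.
    Conversely, for a linear form [l] the map [a |-> l (a - a ^ q)] is a
    derivation over a base ring [B] as soon as [l] kills the class of [p], which
    gives additivity, and the classes of [b - b ^ q] for [b] in [B] (Lemma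
    [Frob_derivation]). Thus the tangent space over [B] is the annihilator of a
    few explicit cotangent vectors. For [B = Z] these are the multiples of the
    class of [d], which is nonzero: the dimension is the embedding dimension
    minus one. For the integers they are the multiples of the class of [p], which
    is zero in case (i) and is the class of [d] in case (ii). All dimensions are
    finite because the classes of [d] and of [chi - eps chi], for [chi]
    irreducible, span the cotangent space (Lemma [cot_gens_span]). *)

(** * Divisibility by a uniformizer in rings generated by a root of unity *)

Section Divides.
Variable R : comNzRingType.
Implicit Types a b d x y z : R.

Definition divides d x := exists w, x = d * w.

Lemma divides_refl d : divides d d. Proof. by exists 1; rewrite mulr1. Qed.
Lemma divides0 d : divides d 0. Proof. by exists 0; rewrite mulr0. Qed.
Lemma dividesD d x y : divides d x -> divides d y -> divides d (x + y).
Proof. by move=> [u ->] [v ->]; exists (u + v); rewrite mulrDr. Qed.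
Lemma dividesN d x : divides d x -> divides d (- x).
Proof. by move=> [u ->]; exists (- u); rewrite mulrN. Qed.
Lemma dividesB d x y : divides d x -> divides d y -> divides d (x - y).
Proof. by move=> dx dy; apply/dividesD/dividesN. Qed.
Lemma dividesMl d x y : divides d x -> divides d (y * x).
Proof. by move=> [u ->]; exists (y * u); rewrite mulrCA. Qed.
Lemma dividesMr d x y : divides d x -> divides d (x * y).
Proof. by rewrite mulrC; apply: dividesMl. Qed.
Lemma divides_mul d e x y : divides d x -> divides e y -> divides (d * e) (x * y).
Proof. by move=> [u ->] [v ->]; exists (u * v); rewrite mulrACA. Qed.
Lemma divides_trans d x y : divides d x -> divides x y -> divides d y.
Proof. by move=> dx [u ->]; apply: dividesMr. Qed.
Lemma divides_sum (I : Type) (s : seq I) (Q : pred I) (F : I -> R) d :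
  (forall i, Q i -> divides d (F i)) -> divides d (\sum_(i <- s | Q i) F i).
Proof.
by move=> dF; elim/big_ind: _ => //; [exact: divides0 | exact: dividesD].
Qed.

Lemma divides_subX d x y k : divides d (x - y) -> divides d (x ^+ k - y ^+ k).
Proof. by move=> dxy; rewrite subrXX; apply: dividesMr. Qed.

Lemma divides_1subX x k : divides (1 - x) (1 - x ^+ k).
Proof.
by rewrite -[X in X - x ^+ k](expr1n _ k); apply/divides_subX/divides_refl.
Qed.

(** The inner binomial coefficients of exponent [p] are multiples of [p]; the
    power [p ^ k] is an iteration. *)
Lemma Frobenius_add p x y k : prime p ->
  divides p%:R ((x + y) ^+ (p ^ k)%N - (x ^+ (p ^ k)%N + y ^+ (p ^ k)%N)).
Proof.
move=> p_pr; have p_gt0 := prime_gt0 p_pr.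
have frob1 a b : divides p%:R ((a + b) ^+ p - (a ^+ p + b ^+ p)).
  case: p p_pr p_gt0 => // p p_pr _; rewrite exprDn big_ord_recl big_ord_recr /=.
  rewrite /bump !add1n bin0 binn subnn subn0 !expr0 mulr1 mul1r.
  rewrite [X in divides _ X](_ : _ = \sum_(i < p) a ^+ (p.+1 - i.+1) * b ^+ i.+1
     *+ 'C(p.+1, i.+1)); last by rewrite !mulr1n; ring.
  apply: divides_sum => i _.
  have /dvdnP[c ->] : (p.+1 %| 'C(p.+1, i.+1))%N.
    by apply: prime_dvd_bin => //=; rewrite ltnS.
  by rewrite mulrnA -[X in divides _ X]mulr_natl; apply/dividesMr/divides_refl.
elim: k => [|k IHk]; first by rewrite expn0 !expr1 subrr; apply: divides0.
rewrite expnSr !exprM.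
have := dividesD (divides_subX p IHk) (frob1 (x ^+ (p ^ k)%N) (y ^+ (p ^ k)%N)).
by rewrite addrA subrK.
Qed.

Lemma divides_geom_sum x k : divides (1 - x) (\sum_(i < k) x ^+ i - k%:R).
Proof.
have -> : k%:R = \sum_(i < k) (1 : R) by rewrite sumr_const card_ord.
rewrite -sumrB; apply: divides_sum => i _.
by rewrite -opprB; apply/dividesN/divides_1subX.
Qed.

Lemma geom_mul x k : 1 - x ^+ k = (1 - x) * \sum_(i < k) x ^+ i.
Proof. by rewrite -opprB subrX1 -mulNr opprB. Qed.

Lemma divides_sum_root w k :
  \sum_(i < k) w ^+ i = 0 -> divides (1 - w) k%:R.
Proof.
move=> w0; have := dividesN (divides_geom_sum w k).
by rewrite w0 sub0r opprK.
Qed.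

(** With [w] a primitive [p]-th root of unity,
    [p = \sum_i (1 - w ^+ i) = (1 - w) * \sum_i \sum_(j < i) w ^+ j], and modulo
    [1 - w] the second factor is [0 + 1 + ... + (p - 1)], a multiple of [p] when
    [p] is odd, hence of [1 - w]. *)
Lemma divides_sq_odd w p : odd p ->
  \sum_(i < p) w ^+ i = 0 -> divides ((1 - w) ^+ 2) p%:R.
Proof.
move=> p_odd w0; have dp := divides_sum_root w0.
have -> : (p%:R : R) = (1 - w) * \sum_(i < p) \sum_(j < i) w ^+ j.
  have -> : (p%:R : R) = \sum_(i < p) (1 : R) by rewrite sumr_const card_ord.
  rewrite mulr_sumr -[LHS]subr0 -[X in _ - X]w0 -sumrB.
  by apply: eq_bigr => i _; rewrite -geom_mul.
rewrite expr2; apply: divides_mul; first exact: divides_refl.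
have -> : \sum_(i < p) \sum_(j < i) w ^+ j
    = \sum_(i < p) (\sum_(j < i) w ^+ j - i%:R) + p%:R * (p.-1./2)%:R.
  rewrite sumrB -natr_sum -natrM -(big_mkord xpredT id) bin2_sum bin2odd //.
  by rewrite subrK.
apply/dividesD/dividesMr => //.
by apply: divides_sum => i _; apply: divides_geom_sum.
Qed.

(** The case of a root of unity [z] of order [p ^ a], [a > 1]: then [w] is a power
    of [z ^+ p], and [1 - z ^+ p] is [1 - z] times a sum of [p] powers of [z],
    which is congruent to [p], hence to [0], modulo [1 - z]. *)
Lemma divides_sq_pow z w p : divides (1 - z ^+ p) (1 - w) ->
  \sum_(i < p) w ^+ i = 0 -> divides ((1 - z) ^+ 2) p%:R.
Proof.
move=> zpw /divides_sum_root wp; have zpp := divides_trans zpw wp.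
apply: divides_trans zpp; rewrite geom_mul.
rewrite expr2; apply: divides_mul; first exact: divides_refl.
have zp : divides (1 - z) p%:R.
  by apply: divides_trans (divides_1subX z p) (divides_trans zpw wp).
rewrite -[X in divides _ X](subrK p%:R).
by apply: dividesD; first exact: divides_geom_sum.
Qed.

(** The solutions of [z = z ^ q] modulo [d], for [q] a power of [p], form a
    subring, since raising to the power [q] is additive modulo [p]. *)
Lemma divides_Frobenius_fix d p k x z : prime p -> divides d p%:R ->
  divides d (x - x ^+ (p ^ k)%N) ->
  (exists r : {poly int}, z = (map_poly intr r).[x]) ->
  divides d (z - z ^+ (p ^ k)%N).
Proof.
move=> p_pr dp dx [r ->]; have p_gt0 := prime_gt0 p_pr.
set q := (p ^ k)%N in dx *; have q_gt0 : (0 < q)%N by rewrite expn_gt0 p_gt0.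
pose S y := divides d (y - y ^+ q).
have frob y1 y2 : divides d ((y1 + y2) ^+ q - (y1 ^+ q + y2 ^+ q)).
  exact: divides_trans dp (Frobenius_add _ _ _ p_pr).
have S0 : S 0 by rewrite /S expr0n eqn0Ngt q_gt0 subr0; apply: divides0.
have S1 : S 1 by rewrite /S expr1n subrr; apply: divides0.
have SD y1 y2 : S y1 -> S y2 -> S (y1 + y2).
  move=> Sy1 Sy2; have := dividesB (dividesD Sy1 Sy2) (frob y1 y2).
  by congr divides; ring.
have SN y : S y -> S (- y).
  move=> Sy; have := dividesD (dividesN Sy) (frob y (- y)).
  by rewrite subrr expr0n eqn0Ngt q_gt0 /= mulr0n; congr divides; ring.
have SM y1 y2 : S y1 -> S y2 -> S (y1 * y2).
  move=> Sy1 Sy2; rewrite /S exprMn.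
  have := dividesD (dividesMl y1 Sy2) (dividesMr (y2 ^+ q) Sy1).
  by congr divides; ring.
have Sn n : S n%:R by elim: n => [|n IHn]; rewrite ?S0 // -addn1 natrD; apply: SD.
have Sz (c : int) : S c%:~R.
  by case: c => n; rewrite ?NegzE ?mulrNz; [|apply: SN]; apply: Sn.
elim/poly_ind: r => [|r c IHr]; first by rewrite rmorph0 horner0.
rewrite rmorphD rmorphM /= map_polyX map_polyC !hornerE.
exact: SD (SM _ _ IHr dx) (Sz c).
Qed.

(** Write [n = p ^ a * m] with [m] prime to [p] and take [q = p ^ k] congruent to
    [1] modulo [m]. Then [x - x ^ q] is a multiple of [1 - x ^ m], where [x ^ m]
    is a root of unity of order [p ^ a]. If [p ^ a > 2], then [d = 1 - x ^ m]
    has the required properties; if [p ^ a] is [1] or [2], then [1 - x ^ m] is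
    [0] or [2], a multiple of [p] in both cases, and [d = p] will do. The
    hypothesis on the sum says that [x ^ (n / p)] behaves as a primitive [p]-th
    root of unity. *)
Lemma exists_uniformizer n p x : prime p -> (0 < n)%N -> x ^+ n = 1 ->
  ((p %| n)%N -> \sum_(i < p) (x ^+ (n %/ p)) ^+ i = 0) ->
  exists d k, [/\ (0 < k)%N, divides d p%:R, exists N, divides p%:R (d ^+ N),
    divides d (x - x ^+ (p ^ k)%N)
    & if (p %| n)%N && ((p != 2%N) || (4 %| n)%N) then divides (d ^+ 2) p%:R
      else d = p%:R].
Proof.
move=> p_pr n_gt0 xn sum0; have p_gt0 := prime_gt0 p_pr.
pose m := (n`_p^')%N; pose a := logn p n.
have nE : n = (p ^ a * m)%N by rewrite -p_part partnC.
have m_gt0 : (0 < m)%N := part_gt0 _ _.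
pose k := totient m; have k_gt0 : (0 < k)%N by rewrite totient_gt0.
have /dvdnP[c pk] : (m %| (p ^ k).-1)%N.
  rewrite -subn1 -eqn_mod_dvd ?expn_gt0 ?p_gt0 //; apply/eqP/Euler_exp_totient.
  by rewrite (pnat_coprime (pnat_id p_pr)) // part_pnat.
have dx d : divides d (1 - x ^+ m) -> divides d (x - x ^+ (p ^ k)%N).
  move=> dm; rewrite -(prednK (_ : 0 < p ^ k)%N) ?expn_gt0 ?p_gt0 // pk exprS.
  rewrite -[X in X - _]mulr1 -mulrBr mulnC exprM; apply: dividesMl.
  by apply: divides_trans dm _; apply: divides_1subX.
case ram: (_ && _).
  case/andP: ram => pn ram; exists (1 - x ^+ m), k.
  have a_gt0 : (0 < a)%N by rewrite logn_gt0 mem_primes p_pr n_gt0.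
  have npE : (n %/ p = m * p ^ a.-1)%N.
    by rewrite nE -{1}(prednK a_gt0) expnS -mulnA mulKn // mulnC.
  have w0 := sum0 pn; rewrite npE exprM in w0.
  suff d2 : divides ((1 - x ^+ m) ^+ 2) p%:R.
    split=> //; last exact/dx/divides_refl.
      by apply: divides_trans d2; apply/dividesMl/divides_refl.
    (* modulo [p], the power [p ^ a] of [1 - x ^ m] is [1 - x ^ n = 0] *)
    exists (p ^ a)%N; have := Frobenius_add 1 (- x ^+ m) a p_pr.
    rewrite expr1n; set y := (X in divides _ X); move=> dy.
    rewrite -[X in divides _ X](subrK (1 + (- x ^+ m) ^+ (p ^ a)%N)) -/y.
    apply: dividesD => //.
    have := Frobenius_add (x ^+ m) (- x ^+ m) a p_pr.
    rewrite subrr expr0n eqn0Ngt expn_gt0 p_gt0 /= -exprM mulnC -nE xn.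
    by rewrite sub0r => /dividesN; rewrite opprK.
  have [a1 | a_neq1] := eqVneq a 1%N.
    rewrite a1 expr1 in w0; apply: divides_sq_odd => //.
    case/orP: ram => [p2 | n4]; first by case: (even_prime p_pr) p2 => ->.
    apply: contraTT n4 => p_even.
    have p2 : p = 2%N by case: (even_prime p_pr) p_even => ->.
    by rewrite -[4%N]/(2 ^ 2)%N pfactor_dvdn // -ltnNge -p2 -/a a1 prime_gt1.
  apply: divides_sq_pow w0.
  rewrite -(prednK (_ : 0 < a.-1)%N) ?expnS ?exprM; first exact: divides_1subX.
  by rewrite -subn1 subn_gt0 ltn_neqAle eq_sym a_neq1.
exists p%:R, k; split=> //; [exact: divides_refl|by exists 1; apply: divides_refl|].
apply: dx; have [pn | pn] := boolP (p %| n)%N; last first.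
  have -> : m = n by rewrite nE /a lognE (negPf pn) !andbF mul1n.
  by rewrite xn subrr; apply: divides0.
move: ram; rewrite pn => /negbT; rewrite negb_or negbK => /andP[/eqP p2 n4].
(* here [p ^ a = 2], so [x ^ m = -1] *)
have a1 : a = 1%N.
  apply/eqP; rewrite eqn_leq {2}/a logn_gt0 mem_primes p_pr n_gt0 pn.
  by rewrite leqNgt -pfactor_dvdn // p2 -[(2 ^ 2)%N]/4%N n4.
have := sum0 pn; rewrite [in (n %/ p)%N]nE a1 mulKn // p2.
rewrite big_ord_recl big_ord1 expr0 expr1 /bump /= => /eqP.
by rewrite addrC addr_eq0 => /eqP ->; rewrite opprK; apply: divides_refl.
Qed.
End Divides.

(** * Squares of ideals and cotangent vectors *)

Lemma gen_submod_ind (R : pzRingType) (V : lmodType R) (E : V -> Prop)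
    (T : V -> Prop) :
  T 0 -> (forall a u v, T u -> T v -> T (a *: u + v)) ->
  (forall e, E e -> T e) -> forall v, v \in gen_submod E -> T v.
Proof.
move=> T0 TP TE v /asboolP /(_ (fun v => `[< T v >])) Tv.
suff /asboolP: v \in (fun v => `[< T v >]) by [].
apply: Tv => [|e /TE Te]; last exact/asboolP.
split=> [|a x y /asboolP Tx /asboolP Ty]; apply/asboolP => //; exact: TP.
Qed.

Section IdealSquare.
Variables (A : comNzRingType) (I : {pred A}).

Lemma ideal_sq_ind (T : A -> Prop) :
  T 0 -> (forall a x y, T x -> T y -> T (a * x + y)) ->
  (forall x y, x \in I -> y \in I -> T (x * y)) ->
  forall z, z \in ideal_sq I -> T z.
Proof.
move=> T0 TD TM z; apply: (@gen_submod_ind A A^o) => // _ [x [y [xI yI ->]]].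
exact: TM.
Qed.

Lemma ideal_sq0 : (0 : A) \in ideal_sq I.
Proof. exact: (@rpred0 A^o). Qed.

Lemma ideal_sqD x y : x \in ideal_sq I -> y \in ideal_sq I -> x + y \in ideal_sq I.
Proof. exact: (@rpredD A^o). Qed.

Lemma ideal_sqMl a x : x \in ideal_sq I -> a * x \in ideal_sq I.
Proof. exact: (@rpredZ A A^o). Qed.

Lemma ideal_sqM x y : x \in I -> y \in I -> x * y \in ideal_sq I.
Proof. by move=> xI yI; apply: mem_gen_submod; exists x, y. Qed.

End IdealSquare.

Section CotangentTheory.
Variables (A : comNzRingType) (P : prime_idealr A).
Local Notation O := (localization P).
Local Notation k := (residue P).
Local Notation m := (loc_max P).

Lemma loc_map_max a : (loc_map P a \in m) = (a \in P).
Proof. exact: frac_max. Qed.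

Lemma ideal_sq_loc_map a : a \in ideal_sq P -> loc_map P a \in ideal_sq m.
Proof.
elim/ideal_sq_ind => [|b x y IHx IHy|x y xP yP].
- by rewrite rmorph0 ideal_sq0.
- by rewrite rmorphD rmorphM; apply: ideal_sqD => //; apply: ideal_sqMl.
- by rewrite rmorphM; apply: ideal_sqM; rewrite loc_map_max.
Qed.

(** The denominators of an expression of [a] in the square of the maximal ideal
    can be cleared by one element outside [P]. *)
Lemma loc_map_ideal_sq a :
  loc_map P a \in ideal_sq m -> exists2 s, s \notin P & s * a \in ideal_sq P.
Proof.
move=> am; suff: exists (b : A) (s : denom P),
    b \in ideal_sq P /\ loc_map P a = frac b s.
  move=> [b [s [bP /eqP/fracP[u]]]]; rewrite dval1 mulr1 => E.
  exists (dval u * dval s); first by rewrite -dvalM dvalP.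
  by rewrite -mulrA [dval s * a]mulrC E; apply: ideal_sqMl.
elim/ideal_sq_ind: (loc_map P a) / am => [|c x y|x y].
- by exists 0, (denom1 P); split; first exact: ideal_sq0.
- move=> [a1 [s [a1P ->]]] [a2 [t [a2P ->]]]; elim/frac_ind: c => c u.
  rewrite fracM fracD; eexists; eexists; split; last by [].
  by apply: ideal_sqD; rewrite mulrC; do 2?apply: ideal_sqMl.
- elim/frac_ind: x => a1 s; elim/frac_ind: y => a2 t; rewrite !frac_max => a1P a2P.
  by rewrite fracM; exists (a1 * a2), (denomM s t); split=> //; apply: ideal_sqM.
Qed.

(** The class of [x] modulo the square of the maximal ideal. It is total, with
    junk value [0] off the maximal ideal, so that membership proofs stay out of
    terms. *)
Definition cot (x : O) : cotangent P :=
  lmod_pi (@loc_max_sq A P) (insubd (0 : loc_max_mod P) x).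

Lemma cot_sub (x : loc_max_mod P) : cot (val x) = lmod_pi (@loc_max_sq A P) x.
Proof. by rewrite /cot valKd. Qed.

Let mk (x : O) (xm : x \in m) : loc_max_mod P := exist _ x xm.

Lemma cot_mk x (xm : x \in m) : cot x = lmod_pi (@loc_max_sq A P) (mk xm).
Proof. exact: (cot_sub (mk xm)). Qed.

Lemma cotD x y : x \in m -> y \in m -> cot (x + y) = cot x + cot y.
Proof.
move=> xm ym; have -> : x + y = val (mk xm + mk ym) by rewrite [RHS]raddfD.
rewrite cot_sub (cot_mk xm) (cot_mk ym).
exact: (raddfD (lmod_pi (@loc_max_sq A P))).
Qed.

Lemma cotM a x : x \in m -> cot (a * x) = residue_map P a *: cot x.
Proof.
move=> xm; have -> : a * x = val (a *: mk xm) by rewrite [RHS]linearZ.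
rewrite cot_sub (cot_mk xm) lmod_piZ.
apply: (residue_scaleP (@residue_actV A P)).
exact: (esym (residue_reprK _)).
Qed.

Lemma cot_eq0 x : x \in m -> (cot x == 0) = (x \in ideal_sq m).
Proof.
move=> xm; rewrite (cot_mk xm).
have -> : (0 : cotangent P) = lmod_pi (@loc_max_sq A P) 0 by rewrite raddf0.
by rewrite [LHS]lmod_piP subr0.
Qed.

Lemma cotP (v : cotangent P) : exists2 x, x \in m & v = cot x.
Proof.
exists (val (lmod_repr v)); first exact: (svalP (lmod_repr v)).
by rewrite cot_sub lmod_reprK.
Qed.

Lemma loc_max0 : (0 : O) \in m. Proof. exact: idealr0. Qed.

Lemma cot0 : cot 0 = 0.
Proof. by apply/eqP; rewrite cot_eq0 ?loc_max0 // ideal_sq0. Qed.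

Lemma loc_maxMl a x : x \in m -> a * x \in m.
Proof. exact: idealMr. Qed.

Lemma cot_sum (I : Type) (r : seq I) (Q : pred I) (F : I -> O) :
  (forall i, Q i -> F i \in m) ->
  cot (\sum_(i <- r | Q i) F i) = \sum_(i <- r | Q i) cot (F i).
Proof.
move=> Fm; suff [] : (\sum_(i <- r | Q i) F i \in m) /\
  cot (\sum_(i <- r | Q i) F i) = \sum_(i <- r | Q i) cot (F i) by [].
elim/big_rec2: _ => [|i y x Qi [xm xE]]; first by rewrite loc_max0 cot0.
by rewrite rpredD ?Fm // cotD ?Fm // xE.
Qed.

End CotangentTheory.

(** * Bases extracted from a finite spanning family *)

Section Basis.
Variables (k : fieldType) (V : lmodType k).
Implicit Types (v w : V) (e s : seq V) (c : nat -> k).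

(** A basis together with its coordinate functions. Tangent vectors are built
    from coordinates of cotangent vectors, and conversely the basis of the
    tangent space has evaluations as its coordinates. *)
Definition dual_basis d (e : 'I_d -> V) (c : 'I_d -> V -> k^o) :=
  [/\ forall j, linear (c j), forall i j, c j (e i) = (i == j)%:R
    & forall v, v = \sum_(j < d) c j v *: e j].

Lemma linear_form0 (c : V -> k^o) : linear c -> c 0 = 0.
Proof. by move=> cl; have := cl (-1) 0 0; rewrite scaler0 addr0 scaleN1r addNr. Qed.

Lemma linear_form_sum d (e : 'I_d -> V) (a : 'I_d -> k) (c : V -> k^o) :
  linear c -> c (\sum_(i < d) a i *: e i) = \sum_(i < d) a i * c (e i).
Proof.
move=> cl.
pose cL : {linear V -> k^o} := HB.pack c (GRing.isLinear.Build _ _ _ _ c cl).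
by rewrite -[c]/(cL : V -> k^o) linear_sum; apply: eq_bigr => i _; rewrite linearZ.
Qed.

Lemma dual_basis_has_dim d (e : 'I_d -> V) (c : 'I_d -> V -> k^o) :
  dual_basis e c -> has_dim V d.
Proof.
move=> [cl ce vE]; exists e => v; exists [ffun j => c j v].
split=> [|a ->]; first by rewrite {1}[v]vE; apply: eq_bigr => j _; rewrite ffunE.
apply/ffunP => j; rewrite ffunE linear_form_sum // (bigD1 j) //= ce eqxx mulr1.
by rewrite big1 ?addr0 // => i /negPf ij; rewrite ce ij mulr0.
Qed.

Definition span_by e v := exists c, v = \sum_(i < size e) c i *: e`_i.
Definition free_by e := forall c,
  \sum_(i < size e) c i *: e`_i = 0 -> forall i, (i < size e)%N -> c i = 0.

Lemma span_by0 e : span_by e 0.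
Proof. by exists (fun=> 0); rewrite big1 // => i _; rewrite scale0r. Qed.

Lemma span_by_mem e v : v \in e -> span_by e v.
Proof.
move=> ve; exists (fun i => (i == index v e)%:R).
have vi : (index v e < size e)%N by rewrite index_mem.
rewrite (bigD1 (Ordinal vi)) //= eqxx scale1r nth_index // big1 ?addr0 // => i.
by rewrite -val_eqE /= => /negPf ->; rewrite scale0r.
Qed.

Lemma sum_rcons e w c : \sum_(i < size (rcons e w)) c i *: (rcons e w)`_i
  = \sum_(i < size e) c i *: e`_i + c (size e) *: w.
Proof.
rewrite size_rcons big_ord_recr /= nth_rcons ltnn eqxx; congr (_ + _).
by apply: eq_bigr => i _; rewrite nth_rcons ltn_ord.
Qed.

Lemma span_by_lin e a v w : span_by e v -> span_by e w -> span_by e (a *: v + w).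
Proof.
move=> [b ->] [c ->]; exists (fun i => a * b i + c i).
by rewrite scaler_sumr -big_split; apply: eq_bigr => i _; rewrite scalerDl scalerA.
Qed.

Lemma span_by_rcons e v w : span_by e v -> span_by (rcons e w) v.
Proof.
move=> [c ->]; pose c' i := if i == size e then 0 else c i.
exists c'; rewrite sum_rcons /c' eqxx scale0r addr0; apply: eq_bigr => i _.
by rewrite (ltn_eqF (ltn_ord i)).
Qed.

Lemma free_by_rcons e w : free_by e -> ~ span_by e w -> free_by (rcons e w).
Proof.
move=> e_free w_out c; rewrite sum_rcons => c0.
have cw : c (size e) = 0.
  apply: contra_notP w_out => /eqP cw; exists (fun i => - (c (size e))^-1 * c i).
  have -> : w = - (c (size e))^-1 *: (- (c (size e) *: w)).
    by rewrite scaleNr scalerN opprK scalerA mulVf // scale1r.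
  move/eqP: c0; rewrite addr_eq0 => /eqP <-; rewrite scaler_sumr.
  by apply: eq_bigr => i _; rewrite scalerA.
move: c0; rewrite cw scale0r addr0 => /e_free c0 i.
by rewrite size_rcons ltnS leq_eqVlt => /predU1P[-> //|]; apply: c0.
Qed.

Lemma free_by_extend s e : free_by e ->
  exists t, [/\ free_by (e ++ t), forall v, span_by e v -> span_by (e ++ t) v
    & forall v, v \in s -> span_by (e ++ t) v].
Proof.
elim: s e => [|w s IHs] e e_free; first by exists [::]; rewrite cats0; split.
have [ew|ew] := EM (span_by e w).
  have [t [t_free et st]] := IHs _ e_free; exists t; split=> // v.
  by rewrite in_cons => /predU1P[->|/st //]; apply: et.
have [t [t_free et st]] := IHs _ (free_by_rcons e_free ew).
rewrite cat_rcons in t_free et st; exists (w :: t); split=> // v.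
  by move=> tangent_ev; apply/et/span_by_rcons.
rewrite in_cons => /predU1P[->|/st //].
by apply/et/span_by_mem; rewrite mem_rcons mem_head.
Qed.

(** Starting the basis at [v0] makes the coordinates of positive index vanish on
    [v0]. *)
Lemma dual_basis_extend s v0 : v0 != 0 -> (forall v, span_by s v) ->
  exists d (e : 'I_d.+1 -> V) (c : 'I_d.+1 -> V -> k^o),
    dual_basis e c /\ e ord0 = v0.
Proof.
move=> v0_neq0 s_span; have free0 : free_by [:: v0].
  move=> c; rewrite big_ord1 => /eqP; rewrite scaler_eq0 (negPf v0_neq0) orbF.
  by move=> /eqP c0 [|i].
have [t [+ _ +]] := free_by_extend s free0; rewrite cat1s.
set e := v0 :: t => e_free sub_span.
have e_span v : span_by e v.
  have [c ->] := s_span v; elim/big_rec: _ => [|i x _ IHx]; first exact: span_by0.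
  by apply: span_by_lin => //; apply: sub_span; rewrite mem_nth.
have [c cE] := choice e_span.
have c_uniq v (a : nat -> k) : v = \sum_(i < size e) a i *: e`_i ->
    forall i, (i < size e)%N -> a i = c v i.
  move=> vE i ie; apply/eqP; rewrite -subr_eq0; apply/eqP.
  apply: (e_free (fun i => a i - c v i)) => //.
  under eq_bigr do rewrite scalerBl.
  by rewrite sumrB -vE -cE subrr.
exists (size t), (fun i => e`_i), (fun j v => c v j); split=> //; split.
- move=> j a u v; apply/esym/(c_uniq _ (fun j => a * c u j + c v j)).
    2: exact: (ltn_ord j).
  rewrite {1}(cE u) {1}(cE v) scaler_sumr -big_split; apply: eq_bigr => i _.
  by rewrite scalerDl scalerA.
- move=> i j; apply/esym/(c_uniq _ (fun j => (i == j :> nat)%:R)).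
    2: exact: (ltn_ord j).
  rewrite (bigD1 i) //= eqxx scale1r big1 ?addr0 // => j' /negPf ij.
  by rewrite eq_sym -[_ == _ :> nat]/(j' == i) ij scale0r.
- by move=> v; exact: cE.
Qed.

End Basis.

(** * Tangent vectors as derivations *)

Section KaehlerTheory.
Variables (B : pzRingType) (O : comNzRingType) (g : {rmorphism B -> O}).

(** The differential of [x], locked so that differentials are compared through
    [x] and not as classes in a quotient. *)
Definition dif (x : O) : kaehler g :=
  locked (lmod_pi (gen_submod (kaehler_rel g)) << x >>).

Lemma kaehler_rel0 w :
  kaehler_rel g w -> lmod_pi (gen_submod (kaehler_rel g)) w = 0.
Proof.
move=> wrel; rewrite -(raddf0 (lmod_pi (gen_submod (kaehler_rel g)))).
by apply/eqP; rewrite lmod_piP subr0 mem_gen_submod.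
Qed.

Lemma difD x y : dif (x + y) = dif x + dif y.
Proof.
rewrite /dif -!lock; have /eqP := kaehler_rel0 (KaehlerD g x y).
by rewrite !raddfB /= -addrA -opprD subr_eq0 => /eqP.
Qed.

Lemma difM x y : dif (x * y) = x *: dif y + y *: dif x.
Proof.
rewrite /dif -!lock; have /eqP := kaehler_rel0 (KaehlerM g x y).
by rewrite !raddfB /= -addrA -opprD subr_eq0 !lmod_piZ => /eqP.
Qed.

Lemma difC b : dif (g b) = 0.
Proof. rewrite /dif -lock; exact: kaehler_rel0 (KaehlerC g b). Qed.

Lemma kaehler_ind (T : kaehler g -> Prop) : T 0 ->
  (forall a x w, T w -> T (a *: dif x + w)) -> forall w, T w.
Proof.
rewrite /dif => T0 TD w; rewrite -[w]lmod_reprK; move: (lmod_repr w) => h.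
rewrite [h]monalgE raddf_sum; elim/big_rec: _ => //= x v _ Tv.
suff -> : << h@_x *g x >> = h@_x *: << x >>.
  by rewrite lmod_piZ; have := TD h@_x x _ Tv; rewrite -lock.
by apply/malgP => y; rewrite mcoeffZ !mcoeffU mulrnAr mulr1.
Qed.

Variables (W : lmodType O) (D : O -> W).
Hypothesis D_add : {morph D : x y / x + y}.
Hypothesis DM : forall x y, D (x * y) = x *: D y + y *: D x.
Hypothesis DC : forall b, D (g b) = 0.

(** The linear map out of the differentials given by their universal property,
    computed on a representative. *)
Definition kaehler_lift (w : kaehler g) : W := mlift D (lmod_repr w).

Lemma kaehler_lift_pi h :
  kaehler_lift (lmod_pi (gen_submod (kaehler_rel g)) h) = mlift D h.
Proof.
apply/eqP; rewrite -subr_eq0 -(raddfB (mlift D)); apply/eqP.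
have : lmod_repr (lmod_pi (gen_submod (kaehler_rel g)) h) - h
    \in gen_submod (kaehler_rel g) by rewrite -lmod_piP lmod_reprK.
apply: (gen_submod_ind (T := fun w => mlift D w = 0)).
- exact: raddf0.
- by move=> a u v IHu IHv; rewrite linearP /= IHu IHv scaler0 addr0.
move=> _ [x y|x y|b].
- by rewrite !raddfB /= !mliftU D_add addrAC addrK subrr.
- by rewrite !raddfB /= !mliftZ !mliftU DM addrAC addrK subrr.
- by rewrite mliftU DC.
Qed.

Lemma kaehler_lift_dif x : kaehler_lift (dif x) = D x.
Proof. by rewrite /dif -lock kaehler_lift_pi mliftU. Qed.

Lemma kaehler_lift_linear : linear kaehler_lift.
Proof.
move=> a x y; rewrite -[x]lmod_reprK -[y]lmod_reprK.
rewrite -(linearP (lmod_pi (gen_submod (kaehler_rel g)))) !kaehler_lift_pi.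
exact: linearP.
Qed.
End KaehlerTheory.

Section TangentTheory.
Variables (B : pzRingType) (O : comNzRingType) (k : comPzRingType).
Variables (g : {rmorphism B -> O}) (res : {rmorphism O -> k}).
Local Notation T := (dual (base_change res (kaehler g))).
Local Notation d := (dif g).

Definition derivation_over (D : O -> k) :=
  [/\ {morph D : x y / x + y}, forall x y, D (x * y) = res x * D y + res y * D x
    & forall b, D (g b) = 0].

Lemma btens_scalel (N : lmodType O) (w : N) (a : O) (s : k) :
  btens res (a *: w) s = res a *: btens res w s.
Proof.
rewrite /btens tensZl -tensZr; apply/esym; exact: base_change_scaleE.
Qed.

Lemma btens_addl (N : lmodType O) (w w' : N) (s : k) :
  btens res (w + w') s = btens res w s + btens res w' s.
Proof. exact: tensDl. Qed.

Lemma btens_0l (N : lmodType O) (s : k) : btens res (0 : N) s = 0.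
Proof.
by apply: (addIr (btens res 0 s)); rewrite -[LHS]tensDl !add0r.
Qed.

(** The value of a tangent vector in the ring [k] instead of the module [k^o]. *)
Definition tangent_ev (phi : T) (v : base_change res (kaehler g)) : k := val phi v.

Lemma tangent_evP (phi : T) c u v :
  tangent_ev phi (c *: u + v) = c * tangent_ev phi u + tangent_ev phi v.
Proof. by have /asboolP phi_lin := svalP phi; apply: phi_lin. Qed.

Lemma tangent_evD (phi : T) u v :
  tangent_ev phi (u + v) = tangent_ev phi u + tangent_ev phi v.
Proof. by have := tangent_evP phi 1 u v; rewrite scale1r mul1r. Qed.

Lemma tangent_ev0 (phi : T) : tangent_ev phi 0 = 0.
Proof. by apply: (addIr (tangent_ev phi 0)); rewrite -tangent_evD !add0r. Qed.

Lemma tangent_evZ (phi : T) c v : tangent_ev phi (c *: v) = c * tangent_ev phi v.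
Proof. by have := tangent_evP phi c v 0; rewrite tangent_ev0 !addr0. Qed.

Definition der_of (phi : T) (x : O) : k := tangent_ev phi (btens res (d x) 1).

Lemma tangent_ev_btensP (phi : T) (a : O) (w w' : kaehler g) (s : k) :
  tangent_ev phi (btens res (a *: w + w') s)
  = res a * tangent_ev phi (btens res w s) + tangent_ev phi (btens res w' s).
Proof. by rewrite btens_addl btens_scalel; apply: tangent_evP. Qed.

Lemma tangent_ev_btensZ (phi : T) (a : O) (w : kaehler g) (s : k) :
  tangent_ev phi (btens res (a *: w) s) = res a * tangent_ev phi (btens res w s).
Proof. by rewrite btens_scalel; apply: tangent_evZ. Qed.

Lemma der_of_derivation phi : derivation_over (der_of phi).
Proof.
split=> [x y|x y|b]; rewrite /der_of.
- by rewrite difD btens_addl; apply: tangent_evD.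
- by rewrite difM [LHS]tangent_ev_btensP; congr (_ + _); apply: tangent_ev_btensZ.
- by rewrite difC btens_0l; apply: tangent_ev0.
Qed.

Lemma der_of_linear c (phi psi : T) x :
  der_of (c *: phi + psi) x = c * der_of phi x + der_of psi x.
Proof. by []. Qed.

Lemma der_of_eq0 phi : (forall x, der_of phi x = 0) -> phi = 0.
Proof.
move=> phi0; suff ev_eq0 w : tangent_ev phi w = 0 by apply/val_inj/funext.
elim/btens_ind: w => [w s|u v u0 v0]; last by rewrite tangent_evD u0 v0 addr0.
have -> : btens res w s = s *: btens res w 1.
  by rewrite [RHS]base_change_scaleE mulr1.
rewrite tangent_evZ; suff -> : tangent_ev phi (btens res w 1) = 0 by rewrite mulr0.
elim/kaehler_ind: w => [|a x w IHw]; first by rewrite btens_0l tangent_ev0.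
rewrite [LHS]tangent_ev_btensP.
transitivity (res a * der_of phi x + 0); last by rewrite phi0 mulr0 addr0.
by congr (_ + _).
Qed.

(* [k] as an [O]-module through [res] *)
Local Notation W := (Defs_restr__canonical__GRing_Lmodule res).

(** The linear form is [dx (x) s |-> s * D x]. *)
Lemma exists_tangent D : derivation_over D -> exists phi : T, der_of phi =1 D.
Proof.
move=> [D_add DM DC]; pose L : kaehler g -> W := kaehler_lift (D : O -> W).
have DW_add : {morph (D : O -> W) : x y / x + y} := D_add.
have Ldif x : L (d x) = D x := kaehler_lift_dif DW_add DM DC x.
have L_lin : linear L := kaehler_lift_linear DW_add DM DC.
move: L Ldif L_lin => L Ldif L_lin.
pose b (w : kaehler g) (s : W) : W := (L w : k) * (s : k).
have bb : bilin b.
  split=> [s|w] a u v; rewrite /b.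
    by rewrite L_lin [LHS]mulrDl; congr (_ + _); apply: esym; apply: mulrA.
  by rewrite [LHS]mulrDr; congr (_ + _); apply: mulrCA.
pose F (w : base_change res (kaehler g)) : k := tlift b w.
have F_add u v : F (u + v) = F u + F v.
  by have := tlift_linear bb 1 u v; rewrite !scale1r.
have F_btens w s : F (btens res w s) = (L w : k) * s := tlift_tens bb w s.
clearbody F; have FZ c u : F (c *: u) = c * F u.
  elim/btens_ind: u => [w s|u1 u2 IH1 IH2].
    have -> : c *: btens res w s = btens res w (c * s) by exact: base_change_scaleE.
    transitivity ((L w : k) * (c * s)); first exact: F_btens.
    by rewrite mulrCA -F_btens.
  transitivity (F (c *: u1) + F (c *: u2)); first by rewrite -F_add scalerDr.
  by rewrite [in RHS]F_add mulrDr; congr (_ + _).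
have F_lin : linear (F : _ -> k^o).
  move=> c u v; transitivity (F (c *: u) + F v); first exact: F_add.
  by rewrite FZ.
exists (exist _ (F : _ -> k^o) (introT (asboolP _) F_lin)) => x.
by transitivity ((L (d x) : k) * 1); [exact: F_btens | rewrite mulr1].
Qed.

End TangentTheory.

Section DerivationDual.
Variables (B : pzRingType) (O : comNzRingType) (k : fieldType).
Variables (g : {rmorphism B -> O}) (res : {rmorphism O -> k}).
Local Notation T := (dual (base_change res (kaehler g))).

(** Tangent vectors dual to the functions [y] form a basis as soon as a
    derivation that vanishes on [y] is zero: their coordinates are the values of
    derivations on [y]. *)
Lemma has_dim_of_derivations r (t : 'I_r -> T) (y : 'I_r -> O) :
  (forall i j, der_of (t i) (y j) = (i == j)%:R) ->
  (forall D, derivation_over g res D -> (forall j, D (y j) = 0) ->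
     D =1 (fun=> 0)) ->
  has_dim T r.
Proof.
move=> ty y_dense; pose c j (phi : T) : k^o := der_of phi (y j).
have c_lin j : linear (c j) by move=> a phi psi; apply: der_of_linear.
have ct i j : c j (t i) = (i == j)%:R by exact: ty.
have c_eq0 phi : (forall j, c j phi = 0) -> phi = 0.
  by move=> c0; apply/der_of_eq0/y_dense; first exact: der_of_derivation.
move: c c_lin ct c_eq0 => c c_lin ct c_eq0.
apply: (@dual_basis_has_dim _ _ _ t c); split=> // phi.
set psi := \sum_(j < r) _; suff: (-1) *: psi + phi = 0.
  by rewrite scaleN1r addrC => /eqP; rewrite subr_eq0 => /eqP.
apply: c_eq0 => j; rewrite c_lin.
have -> : c j psi = c j phi; last by rewrite scaleN1r addNr.
rewrite /psi linear_form_sum // (bigD1 j) //= ct eqxx mulr1 big1 ?addr0 // => i.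
by move=> /negPf ij; rewrite ct ij mulr0.
Qed.

End DerivationDual.

(** * Derivations from cotangent vectors through a Frobenius power *)

Section FrobeniusDerivation.
Variables (A : comNzRingType) (P : prime_idealr A) (p k : nat).
Local Notation O := (localization P).
Local Notation kP := (residue P).
Local Notation res := (residue_map P).
Local Notation m := (loc_max P).
Local Notation q := (p ^ k)%N.
Hypotheses (p_pr : prime p) (k_gt0 : (0 < k)%N) (pP : p%:R \in P).
Hypothesis Frob_fix : forall a, a - a ^+ q \in P.

Lemma loc_max_p : (p%:R : O) \in m.
Proof. by rewrite -(rmorph_nat (loc_map P)) loc_map_max. Qed.

Lemma residue_p : (p%:R : kP) = 0.
Proof. by apply/eqP; rewrite -(rmorph_nat res) residue_map_eq0 loc_max_p. Qed.

Lemma Frob_gt1 : (1 < q)%N.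
Proof. by rewrite -(expn0 p) ltn_exp2l // prime_gt1. Qed.

Lemma fracX (a : A) (s : denom P) i : (0 < i)%N ->
  exists2 t : denom P, dval t = dval s ^+ i & frac a s ^+ i = frac (a ^+ i) t.
Proof.
case: i => // i _; elim: i => [|i [t tE IHi]]; first by exists s; rewrite ?expr1.
exists (denomM s t); first by rewrite dvalM tE -exprS.
by rewrite exprS IHi fracM -exprS.
Qed.

Lemma loc_max_Frob (x : O) : x - x ^+ q \in m.
Proof.
elim/frac_ind: x => a s; have [t tE ->] := fracX a s (ltnW Frob_gt1).
rewrite fracN fracD frac_max tE.
have -> : a * dval s ^+ q + - a ^+ q * dval s
    = dval s * (a - a ^+ q) - a * (dval s - dval s ^+ q) by ring.
by rewrite rpredB ?idealMr.
Qed.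

Lemma residue_Frob x : res (x ^+ q) = res x.
Proof.
apply/eqP; rewrite eq_sym -subr_eq0 -rmorphB residue_map_eq0; exact: loc_max_Frob.
Qed.

Lemma cot_Frob0 x : x \in m -> cot (x ^+ q) = 0.
Proof.
move=> xm; apply/eqP; case: (q) Frob_gt1 => [|[|i]] // _.
rewrite exprSr exprS -mulrA mulrCA cot_eq0; first by apply/ideal_sqMl/ideal_sqM.
by apply/loc_maxMl/loc_maxMl.
Qed.

Lemma cot_Frob x : x \in m -> cot (x - x ^+ q) = cot x.
Proof.
move=> xm; have xqm : x ^+ q \in m.
  by rewrite -(prednK (ltnW Frob_gt1)) exprSr; apply: loc_maxMl.
rewrite -mulN1r (cotD xm (loc_maxMl (-1) xqm)) (cotM (-1) xqm).
by rewrite cot_Frob0 // scaler0 addr0.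
Qed.

Section Derivation.
Variables (B : pzRingType) (f : {rmorphism B -> A}) (D : O -> kP).
Hypothesis D_der : derivation_over (stalk_map f P) res D.

Let D_add : {morph D : x y / x + y}. Proof. by case: D_der. Qed.
Let DM x y : D (x * y) = res x * D y + res y * D x. Proof. by case: D_der. Qed.

Let D0 : D 0 = 0.
Proof. by apply: (addIr (D 0)); rewrite -D_add !add0r. Qed.

Let DB x y : D (x - y) = D x - D y.
Proof. by apply: (addIr (D y)); rewrite -D_add !subrK. Qed.

Lemma derivationX x i : D (x ^+ i.+1) = i.+1%:R * res x ^+ i * D x.
Proof.
elim: i => [|i IHi]; first by rewrite mulr1 mul1r.
by rewrite exprS DM IHi rmorphXn -[i.+2]addn1 natrD /= exprS; ring.
Qed.

Lemma derivation_max_sq u : u \in ideal_sq m -> D u = 0.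
Proof.
suff H : u \in ideal_sq m -> u \in m /\ D u = 0 by move=> /H[].
elim/ideal_sq_ind => [|a x y [xm x0] [ym y0]|x y xm ym].
- by rewrite loc_max0 D0.
- rewrite D_add DM x0 y0 rpredD ?loc_maxMl // mulr0 add0r addr0; split=> //.
  by move: xm; rewrite -residue_map_eq0 => /eqP ->; rewrite mul0r.
- rewrite loc_maxMl // DM; split=> //; move: xm ym; rewrite -!residue_map_eq0.
  by move=> /eqP -> /eqP ->; rewrite !mul0r addr0.
Qed.

Lemma derivation_cot u v : u \in m -> v \in m -> cot u = cot v -> D u = D v.
Proof.
move=> um vm uv; apply/eqP; rewrite -subr_eq0 -DB; apply/eqP.
apply: derivation_max_sq; rewrite -cot_eq0 ?rpredB //.
by rewrite -mulN1r cotD ?loc_maxMl // cotM // uv rmorphN1 scaleN1r subrr.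
Qed.

(** [D] kills [x ^ q], as [q = 0] in the residue field. *)
Lemma derivation_Frob x : D x = D (x - x ^+ q).
Proof.
rewrite DB -(prednK (ltnW Frob_gt1)) derivationX prednK ?(ltnW Frob_gt1) //.
by rewrite natrX residue_p expr0n eqn0Ngt k_gt0 !mul0r subr0.
Qed.

Lemma derivation_eq0 N (e : 'I_N -> cotangent P) c (x : 'I_N -> O) :
  dual_basis e c -> (forall i, x i \in m /\ cot (x i) = e i) ->
  (forall i, D (x i) = 0) -> forall y, D y = 0.
Proof.
move=> [_ _ vE] xE Dx y; rewrite derivation_Frob.
have zm := loc_max_Frob y; move: (y - _) zm => z zm.
pose a i := residue_repr (c i (cot z)).
have axm i : a i * x i \in m by apply: loc_maxMl; case: (xE i).
have sm : \sum_(i < N) a i * x i \in m by apply: rpred_sum => i _.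
rewrite (derivation_cot zm sm); last first.
  rewrite cot_sum // [LHS]vE; apply: eq_bigr => i _.
  by case: (xE i) => xm <-; rewrite cotM // residue_reprK.
elim/big_rec: _ => [|i u _ Du]; first exact: D0.
have [xm _] := xE i.
have x0 : res (x i) = 0 by apply/eqP; rewrite residue_map_eq0.
by rewrite D_add Du DM Dx x0 mulr0 mul0r !addr0.
Qed.

End Derivation.

(** The defect of additivity of [x |-> x - x ^ q] is a multiple of [p], and
    [x * y - (x * y) ^ q = x * (y - y ^ q) + y ^ q * (x - x ^ q)], where [y ^ q]
    and [y] have the same residue. *)
Lemma Frob_derivation (B : pzRingType) (f : {rmorphism B -> A})
    (l : cotangent P -> kP^o) :
  linear l -> l (cot p%:R) = 0 ->
  (forall b, l (cot (stalk_map f P b - stalk_map f P b ^+ q)) = 0) ->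
  derivation_over (stalk_map f P) res (fun x => l (cot (x - x ^+ q))).
Proof.
move=> l_lin lp lB.
have lD u v : l (u + v) = l u + l v by have := l_lin 1 u v; rewrite !scale1r.
have l0 : l 0 = 0 by apply: (addIr (l 0)); rewrite -lD !add0r.
have lZ a u : l (a *: u) = a * l u by have := l_lin a u 0; rewrite l0 !addr0.
have F := loc_max_Frob; split=> // x y.
- have [w /eqP wE] := Frobenius_add x y k p_pr.
  have -> : x + y - (x + y) ^+ q = (x - x ^+ q) + (y - y ^+ q) + (- w) * p%:R.
    move: wE; rewrite subr_eq => /eqP ->; ring.
  have xym : (x - x ^+ q) + (y - y ^+ q) \in m by apply: rpredD.
  rewrite (cotD xym (loc_maxMl (- w) loc_max_p)) (cotD (F x) (F y)).
  by rewrite (cotM (- w) loc_max_p) lD lZ lp mulr0 addr0 lD.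
- have -> : x * y - (x * y) ^+ q = x * (y - y ^+ q) + y ^+ q * (x - x ^+ q).
    by rewrite exprMn; ring.
  rewrite (cotD (loc_maxMl x (F y)) (loc_maxMl (y ^+ q) (F x))).
  by rewrite (cotM x (F y)) (cotM (y ^+ q) (F x)) lD !lZ residue_Frob.
Qed.

(** The [j]-th basis vector is [x |-> c (J j) (x - x ^ q)]. A derivation that
    vanishes on the cotangent basis is zero, and it vanishes on the members left
    out by [J] because they come from the base ring. *)
Lemma tangent_has_dim (B : pzRingType) (f : {rmorphism B -> A}) N r
    (e : 'I_N -> cotangent P) c (J : 'I_r -> 'I_N) :
  dual_basis e c -> injective J ->
  (forall j, c (J j) (cot p%:R) = 0) ->
  (forall j b, c (J j) (cot (stalk_map f P b - stalk_map f P b ^+ q)) = 0) ->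
  (forall i, (exists j, i = J j) \/
     exists2 b, stalk_map f P b \in m & e i = cot (stalk_map f P b)) ->
  has_dim (tangent f P) r.
Proof.
move=> ec J_inj cp cB eJ; have [c_lin ce _] := ec.
have /choice[x xE] i : exists x, x \in m /\ cot x = e i.
  by have [x xm ->] := cotP (e i); exists x.
have /choice[t tE] j :=
  exists_tangent (Frob_derivation (c_lin (J j)) (cp j) (cB j)).
apply: (has_dim_of_derivations (t := t) (y := x \o J)) => [i j|D D_der Dx] /=.
  rewrite tE; have [xm xe] := xE (J j).
  by rewrite cot_Frob // xe ce (inj_eq J_inj) eq_sym.
apply: (derivation_eq0 D_der ec xE) => i; have [[j ->]|[b bm eb]] := eJ i.
  exact: Dx.
have [xm xe] := xE i; have [_ _ DC] := D_der.
by rewrite (derivation_cot D_der xm bm) ?DC ?xe.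
Qed.

End FrobeniusDerivation.

(** * Points on a section of the structure morphism *)

Section RetractedPoint.
Variables (Z A : comNzRingType).
Variables (iota : {rmorphism Z -> A}) (eps : {rmorphism A -> Z}).
Variables (P : prime_idealr A) (p k : nat) (d : Z).
Local Notation q := (p ^ k)%N.
Hypothesis iotaK : cancel iota eps.
Hypothesis eps_mod : forall a, a - iota (eps a) \in P.
Hypotheses (p_pr : prime p) (k_gt0 : (0 < k)%N) (pP : p%:R \in P).
Hypothesis Z_domain : forall x y : Z, x * y = 0 -> x = 0 \/ y = 0.
Hypothesis d_neq0 : d <> 0.
Hypotheses (d_p : divides d p%:R) (p_d : exists N, divides p%:R (d ^+ N)).
Hypothesis Z_Frob : forall z, divides d (z - z ^+ q).

Lemma prime_idealX (a : A) i : a ^+ i \in P -> a \in P.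
Proof.
elim: i => [|i IHi]; first by rewrite expr0 idealr1.
by rewrite exprS prime_idealrM => /orP[].
Qed.

Lemma iota_d : iota d \in P.
Proof.
have [N [w dN]] := p_d; apply: (@prime_idealX _ N).
by rewrite -rmorphXn dN rmorphM rmorph_nat mulrC idealMr.
Qed.

Lemma iota_divides z : divides d z -> iota z \in P.
Proof. by move=> [w ->]; rewrite rmorphM mulrC idealMr ?iota_d. Qed.

Lemma point_Frob a : a - a ^+ q \in P.
Proof.
have -> : a - a ^+ q = (a - iota (eps a)) + iota (eps a - eps a ^+ q)
    - (a ^+ q - iota (eps a) ^+ q) by rewrite rmorphB rmorphXn; ring.
have duP := iota_divides (Z_Frob (eps a)).
by apply: (rpredB (rpredD (eps_mod a) duP)); rewrite subrXX mulrC idealMr.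
Qed.

(** An element [z] of the prime below [P] has a multiple divisible by [d], namely
    [(1 - z ^ (q - 1)) * z = z - z ^ q], and the factor is outside the prime. *)
Lemma ideal_sq_eps x : x \in ideal_sq P ->
  exists2 K, iota K \notin P & divides (d ^+ 2) (K * eps x).
Proof.
have q_gt1 : (1 < q)%N := Frob_gt1 p_pr k_gt0.
have near u : u \in P -> exists2 K, iota K \notin P & divides d (K * eps u).
  move=> uP; exists (1 - eps u ^+ q.-1); last first.
    by rewrite mulrBl mul1r -exprSr prednK ?(ltnW q_gt1).
  have euP : iota (eps u) \in P.
    by rewrite -[iota _](subKr u) rpredB.
  apply/negP => KP; have := idealr1 P; rewrite -[1](subrK (iota (eps u) ^+ q.-1)).
  rewrite rpredD //; first by move: KP; rewrite rmorphB rmorph1 rmorphXn.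
  by rewrite -(prednK (_ : 0 < q.-1)%N) -?subn1 ?subn_gt0 // exprSr idealMr.
elim/ideal_sq_ind => [|a y z [K KP dK] [L LP dL]|y z yP zP].
- by exists 1; rewrite ?rmorph1 ?idealr1 // rmorph0 mulr0; apply: divides0.
- exists (K * L); first by rewrite rmorphM prime_idealrM negb_or KP.
  rewrite rmorphD rmorphM.
  have -> : K * L * (eps a * eps y + eps z)
    = L * eps a * (K * eps y) + K * (L * eps z) by ring.
  by apply: dividesD; apply: dividesMl.
- have [K KP dK] := near y yP; have [L LP dL] := near z zP.
  exists (K * L); first by rewrite rmorphM prime_idealrM negb_or KP.
  by rewrite rmorphM mulrACA expr2; apply: divides_mul.
Qed.

(** If [s * d] were in the square of [P], then [K * eps s * d] would be a multiple
    of [d ^ 2] for some [K] outside [P]; cancelling [d] puts [K * eps s] in [P]. *)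
Lemma d_notin_sq s : s \notin P -> s * iota d \notin ideal_sq P.
Proof.
move=> sP; apply/negP => /ideal_sq_eps[K KP [w]].
rewrite rmorphM iotaK expr2 mulrA [d * d * w]mulrAC => /eqP.
rewrite -subr_eq0 -mulrBl => /eqP/Z_domain[/eqP|//]; rewrite subr_eq0 => /eqP E.
have : iota (K * eps s) \in P.
  by rewrite E; apply/iota_divides/dividesMr/divides_refl.
rewrite rmorphM prime_idealrM (negPf KP) /= => esP; case/negP: sP.
by rewrite -[s](subrK (iota (eps s))) rpredD.
Qed.

Local Notation m := (loc_max P).
Local Notation loc := (loc_map P).
Local Notation cot_d := (cot (loc (iota d))).

Lemma loc_d : loc (iota d) \in m. Proof. by rewrite loc_map_max iota_d. Qed.

Lemma cot_d_neq0 : cot_d != 0.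
Proof.
rewrite cot_eq0 ?loc_d //; apply/negP => /loc_map_ideal_sq[s sP].
by apply/negP/d_notin_sq.
Qed.

Lemma cot_divides z : divides d z -> exists a, cot (loc (iota z)) = a *: cot_d.
Proof.
move=> [w ->]; exists (residue_map P (loc (iota w))).
by rewrite mulrC !rmorphM /= cotM ?loc_d.
Qed.

Variable s : seq A.
Hypothesis s_span : forall a, exists c : nat -> Z,
  a = \sum_(i < size s) iota (c i) * s`_i.

Definition cot_gens : seq (cotangent P) :=
  cot_d :: [seq cot (loc (a - iota (eps a))) | a <- s].

(** Split [u] in [P] as [u - iota z], [iota (z - z ^ q)] and [iota z ^ q] with
    [z = eps u]: the first is a combination of the [a - iota (eps a)] for [a] in
    [s], the second a multiple of [d], and the third is in the square of [P]. *)
Lemma cot_gens_span v : span_by cot_gens v.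
Proof.
have spanZ a u : span_by cot_gens u -> span_by cot_gens (a *: u).
  by move=> /(span_by_lin a) /(_ (span_by0 _)); rewrite addr0.
have spanD u w :
    span_by cot_gens u -> span_by cot_gens w -> span_by cot_gens (u + w).
  by move=> /(span_by_lin 1); rewrite scale1r; apply.
have [x xm ->] := cotP v; elim/frac_ind: x xm => u t; rewrite frac_max => uP.
have -> : frac u t = frac 1 t * loc u.
  by rewrite /loc_map fracM; apply: frac_eq; rewrite dvalM dval1; ring.
rewrite cotM ?loc_map_max //; apply/spanZ.
have euP : iota (eps u) \in P by rewrite -[iota _](subKr u) rpredB.
have lm a : a \in P -> loc a \in m by rewrite loc_map_max.
have duP : iota (eps u - eps u ^+ q) \in P by apply: iota_divides.
have euqP : iota (eps u) ^+ q \in P.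
  by rewrite -(prednK (ltnW (Frob_gt1 p_pr k_gt0))) exprSr idealMr.
have -> : loc u = loc (u - iota (eps u)) + loc (iota (eps u - eps u ^+ q))
    + loc (iota (eps u) ^+ q).
  by rewrite -!rmorphD; congr loc; rewrite rmorphB rmorphXn; ring.
have u1m := lm _ (eps_mod u); have u2m := lm _ duP.
rewrite (cotD (rpredD u1m u2m) (lm _ euqP)) (cotD u1m u2m) (rmorphXn loc).
rewrite (cot_Frob0 p_pr k_gt0 (lm _ euP)) addr0; apply/spanD; last first.
  have [a ->] := cot_divides (Z_Frob (eps u)); apply/spanZ.
  by apply: span_by_mem; rewrite mem_head.
have [c uE] := s_span u.
have -> : u - iota (eps u)
    = \sum_(i < size s) iota (c i) * (s`_i - iota (eps s`_i)).
  rewrite {1}uE {1}uE !rmorph_sum -sumrB; apply: eq_bigr => i _.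
  by rewrite !rmorphM iotaK mulrBr.
rewrite rmorph_sum cot_sum => [|i _]; last first.
  by rewrite rmorphM loc_maxMl //; apply: lm.
elim/big_rec: _ => [|i w _ IHw]; first exact: span_by0.
rewrite rmorphM cotM; last exact: lm.
apply/spanD => //; apply/spanZ/span_by_mem; rewrite in_cons; apply/orP; right.
by apply: map_f; rewrite mem_nth.
Qed.

(** Take a basis of the cotangent space that starts with the class of [d]. The
    coordinates other than the first give the tangent vectors over [Z], since [d]
    comes from [Z]. Over the integers all coordinates are allowed when the class
    of [p] is zero; otherwise [d = p] and the first one is excluded again. *)
Lemma tangent_dimensions (f : {rmorphism int -> A}) (ram : bool) :
  (if ram then divides (d ^+ 2) p%:R else d = p%:R) ->
  (ram = (p%:R \in ideal_sq P)) /\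
  exists r, [/\ has_dim (tangent iota P) r,
                has_dim (tangent f P) (ram + r) & has_dim (cotangent P) r.+1].
Proof.
move=> ramP.
have ram_sq : ram = (p%:R \in ideal_sq P).
  case: ram ramP => [[w pE] | dE]; apply/esym.
    have -> : (p%:R : A) = iota w * (iota d * iota d).
      by rewrite -[LHS](rmorph_nat iota) pE expr2 !rmorphM mulrC.
    exact/ideal_sqMl/ideal_sqM/iota_d/iota_d.
  apply/negbTE; rewrite -(rmorph_nat iota) -dE -[iota d]mul1r.
  by apply: d_notin_sq; rewrite idealr1.
split=> //.
have [r [e [c [ec e0]]]] := dual_basis_extend cot_d_neq0 cot_gens_span.
have [c_lin ce _] := ec; exists r.
have cZ0 j a v : c j v = 0 -> c j (a *: v) = 0.
  by move=> cv; have := c_lin j a v 0; rewrite linear_form0 // cv !addr0 scaler0.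
have c_divides (j : 'I_r) z :
    divides d z -> c (lift ord0 j) (cot (loc (iota z))) = 0.
  by move=> /cot_divides[a ->]; rewrite cZ0 // -e0 ce.
have p_loc : (p%:R : localization P) = loc (iota p%:R) by rewrite !rmorph_nat.
have c_p j : c (lift ord0 j) (cot p%:R) = 0 by rewrite p_loc c_divides.
(* Fermat: the integers are the polynomials in [1] *)
have int_Frob b : exists w : A, f b - f b ^+ q = p%:R * w.
  apply: (@divides_Frobenius_fix _ p%:R p k 1) => //; first exact: divides_refl.
    by rewrite expr1n subrr; apply: divides0.
  by exists b%:P; rewrite map_polyC hornerC /= -[b in LHS]intz rmorph_int.
have int_locE b : stalk_map f P b - stalk_map f P b ^+ q = loc (f b - f b ^+ q).
  by rewrite rmorphB rmorphXn.
have lift_inj0 : injective (@lift r.+1 ord0) by apply: lift_inj.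
have pm : (p%:R : localization P) \in m := loc_max_p pP.
split; last exact: dual_basis_has_dim ec.
- apply: (tangent_has_dim p_pr k_gt0 pP point_Frob ec lift_inj0) => // [j b|i].
    rewrite [X in cot X](_ : _ = loc (iota (b - b ^+ q))) ?c_divides //.
    by rewrite !(rmorphB, rmorphXn).
  case: (unliftP ord0 i) => [j ->|->]; [left; by exists j | right].
  by exists d; [exact: loc_d | rewrite e0].
have int_Frob0 j : c j (cot p%:R) = 0 -> forall b,
    c j (cot (stalk_map f P b - stalk_map f P b ^+ q)) = 0.
  move=> cp b; rewrite int_locE; have [w ->] := int_Frob b.
  by rewrite mulrC rmorphM rmorph_nat cotM // cZ0.
case: ram ramP ram_sq => /= [_ p_sq | dE _].
- have cp0 j : c j (cot (p%:R : localization P)) = 0.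
    have -> : cot (p%:R : localization P) = 0.
      apply/eqP; rewrite cot_eq0 // -(rmorph_nat loc).
      by apply: ideal_sq_loc_map; rewrite -p_sq.
    exact/linear_form0/c_lin.
  apply: (tangent_has_dim p_pr k_gt0 pP point_Frob ec (@inj_id 'I_r.+1)) => //.
  + by move=> j b; apply: int_Frob0.
  + by move=> i; left; exists i.
- apply: (tangent_has_dim p_pr k_gt0 pP point_Frob ec lift_inj0) => // [j b|i].
    exact: int_Frob0.
  case: (unliftP ord0 i) => [j ->|->]; [left; by exists j | right].
  exists p%:R; rewrite [stalk_map _ _ _]rmorph_nat //.
  by rewrite e0 dE p_loc.
Qed.

End RetractedPoint.

(** * The ring generated by a root of unity *)

Section IntAdjoin.
Variables (n : nat) (xi : algC).
Hypothesis xi_prim : n.-primitive_root xi.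
Local Notation Z := (int_adjoin xi).

Lemma int_adjoinP (z : algC) :
  reflect (exists r : {poly int}, z = (map_poly intr r).[xi])
    (z \in int_adjoin_pred xi).
Proof. exact: asboolP. Qed.

Lemma int_adjoin_gen : xi \in int_adjoin_pred xi.
Proof. by apply/int_adjoinP; exists 'X; rewrite map_polyX hornerX. Qed.

Definition xiZ : Z := exist _ xi int_adjoin_gen.

Lemma int_adjoin_poly (z : Z) :
  exists r : {poly int}, z = (map_poly intr r).[xiZ].
Proof.
have /int_adjoinP[r zE] := valP z; exists r; apply: val_inj.
rewrite [LHS]zE; apply: etrans (horner_map _ (map_poly intr r) xiZ).
rewrite -map_poly_comp; congr horner.
by apply: eq_map_poly => c; apply/esym/rmorph_int.
Qed.

Lemma int_adjoin_domain (x y : Z) : x * y = 0 -> x = 0 \/ y = 0.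
Proof.
move=> /(congr1 val)/eqP; rewrite rmorphM rmorph0 mulf_eq0.
by case/orP => /eqP E; [left | right]; apply: val_inj; rewrite E rmorph0.
Qed.

Lemma natr_int_adjoin_neq0 p : (0 < p)%N -> (p%:R : Z) <> 0.
Proof.
move=> p_gt0 /(congr1 val)/eqP; rewrite rmorph_nat rmorph0 pnatr_eq0.
by rewrite eqn0Ngt p_gt0.
Qed.

Lemma xiZ_unity : xiZ ^+ n = 1.
Proof. by apply: val_inj; rewrite rmorphXn rmorph1 /= prim_expr_order. Qed.

Lemma xiZ_sum p : prime p -> (p %| n)%N ->
  \sum_(i < p) (xiZ ^+ (n %/ p)) ^+ i = 0.
Proof.
move=> p_pr pn; have n_gt0 := prim_order_gt0 xi_prim.
have w_neq1 : 1 - xiZ ^+ (n %/ p) <> 0.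
  move=> /(congr1 val)/eqP; rewrite rmorphB rmorph1 rmorph0 rmorphXn /=.
  rewrite subr_eq0 eq_sym.
  rewrite -(prim_order_dvd xi_prim) => /dvdn_leq.
  rewrite divn_gt0 ?prime_gt0 // (dvdn_leq n_gt0 pn) leqNgt ltn_Pdiv ?prime_gt1 //.
  by move=> /(_ isT).
have [] // : 1 - xiZ ^+ (n %/ p) = 0 \/ \sum_(i < p) (xiZ ^+ (n %/ p)) ^+ i = 0.
by apply: int_adjoin_domain; rewrite -geom_mul -exprM divnK // xiZ_unity subrr.
Qed.

End IntAdjoin.

(** * Evaluations of characters *)

Lemma tensor_ring_lift (R Z : comPzRingType) (u : {rmorphism R -> Z}) :
  exists eps : tensor_ring R Z -> Z,
    [/\ zmod_morphism eps, monoid_morphism eps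
      & forall r z, eps (rtens r z) = u r * z].
Proof.
pose b (r : zmodule R) (z : zmodule Z) : zmodule Z := u (r : R) * (z : Z).
have bb : bilin b.
  split=> [z|r]; apply: int_linear => x y; rewrite /b.
    by rewrite (rmorphD u) [LHS]mulrDl.
  by rewrite [LHS]mulrDr.
pose eps (w : tensor_ring R Z) : Z := tlift b w.
have epsE r z : eps (rtens r z) = u r * z := tlift_tens bb r z.
have epsD : {morph eps : v w / v + w}.
  by move=> v w; have := tlift_linear bb 1 v w; rewrite !scale1r.
move: eps epsE epsD => eps epsE epsD; exists eps; split=> //.
  by move=> v w; apply: (addIr (eps w)); rewrite -epsD !subrK.
split; first by rewrite epsE rmorph1 mulr1.
move=> v w; elim/rtens_ind: v => [r z|v1 v2 IH1 IH2]; last first.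
  rewrite [in LHS]mulrDl [LHS]epsD (epsD v1) [RHS]mulrDl.
  by congr (_ + _); [exact: IH1 | exact: IH2].
elim/rtens_ind: w => [r' z'|w1 w2 IH1 IH2]; last first.
  rewrite [in LHS]mulrDr [LHS]epsD (epsD w1) [RHS]mulrDr.
  by congr (_ + _); [exact: IH1 | exact: IH2].
have -> : rtens r z * rtens r' z' = rtens (r * r') (z * z').
  exact: tensor_ring_mulE.
transitivity (u (r * r') * (z * z')); first exact: epsE.
rewrite rmorphM mulrACA; congr (_ * _); exact/esym/epsE.
Qed.

Section RepRing.
Variables (gT : finGroupType) (G : {group gT}) (xi : algC).
Hypothesis xi_prim : #|G|.-primitive_root xi.
Local Notation Z := (int_adjoin xi).
Local Notation A := (rep_ring_xi G xi).

(** The value of a character at [g] is a sum of eigenvalues, which are roots of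
    unity of order dividing that of [G]. *)
Lemma char_int_adjoin (phi : 'CF(G)) g : g \in G ->
  phi \in 'Z[irr G]%g -> phi g \in int_adjoin_pred xi.
Proof.
move=> gG /vcharP[chi1 chi1P [chi2 chi2P ->]]; rewrite !cfunE.
have char_in (chi : 'CF(G)) : chi \is a character -> chi g \in int_adjoin_pred xi.
  move=> /char_reprP[[f rG] ->].
  have [e [_ [e1 _] [-> _] _]] := repr_rsim_diag rG gG.
  apply: rpred_sum => i _; have : e 0 i ^+ #|G| = 1.
    by have /dvdnP[c ->] := cyclic.order_dvdG gG; rewrite mulnC exprM e1 expr1n.
  by move=> /(prim_rootP xi_prim)[j ->]; apply/rpredX/int_adjoin_gen.
by rewrite rpredB ?char_in.
Qed.

Definition is_eval g (eps : {rmorphism A -> Z}) :=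
  forall (phi : rep_ring G) z,
    val (eps (rtens phi z)) = (val phi : 'CF(G)) g * val z.

Lemma exists_evaluation g :
  g \in G -> exists eps : {rmorphism A -> Z}, is_eval g eps.
Proof.
move=> gG.
pose u (phi : rep_ring G) : Z :=
  exist _ (val phi g) (char_int_adjoin gG (valP phi)).
have uB : zmod_morphism u.
  move=> phi psi; apply: val_inj; rewrite [RHS]raddfB.
  transitivity ((val phi - val psi : 'CF(G)) g); last by rewrite !cfunE.
  by rewrite -raddfB.
have uM : monoid_morphism u.
  split=> [|phi psi]; apply: val_inj.
    by transitivity ((1 : 'CF(G)) g); last by rewrite cfun1E gG.
  by transitivity ((val phi * val psi : 'CF(G)) g); last by rewrite cfunE.
pose uR : {rmorphism rep_ring G -> Z} := HB.pack u
  (GRing.isZmodMorphism.Build _ _ u uB) (GRing.isMonoidMorphism.Build _ _ u uM).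
have [eps [epsB epsM epsE]] := tensor_ring_lift uR.
pose epsR : {rmorphism A -> Z} := HB.pack (eps : A -> Z)
  (GRing.isZmodMorphism.Build A Z eps epsB)
  (GRing.isMonoidMorphism.Build A Z eps epsM).
exists epsR => phi z; transitivity (val (u phi * z)); first by rewrite -epsE.
by rewrite [LHS]rmorphM.
Qed.

Definition chiR i : rep_ring G := exist _ 'chi_i (irr_vchar i).

Lemma rep_ring_expansion (phi : rep_ring G) :
  exists c : Iirr G -> int, phi = \sum_i chiR i *~ c i.
Proof.
have /choice[c cE] i : exists m : int, '[val phi, 'chi_i] = m%:~R.
  by apply/intrP/Cint_cfdot_vchar_irr/valP.
exists c; apply: val_inj; rewrite [LHS]cfun_sum_cfdot [RHS]raddf_sum.
by apply: eq_bigr => i _; rewrite cE scaler_int [RHS]raddfMz.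
Qed.

Local Notation inZ := (rep_ring_xi_in G xi).

Lemma inZ_mul z phi w : inZ z * rtens phi w = rtens phi (z * w) :> A.
Proof. by rewrite [LHS]tensor_ring_mulE mul1r. Qed.

Lemma rep_ring_xi_expansion (a : A) :
  exists c : Iirr G -> Z, a = \sum_i inZ (c i) * rtens (chiR i) 1.
Proof.
elim/rtens_ind: a => [phi z|a b [c ->] [c' ->]]; last first.
  exists (fun i => c i + c' i); rewrite -big_split; apply: eq_bigr => i _.
  by rewrite rmorphD mulrDl.
have [c phiE] := rep_ring_expansion phi; exists (fun i => z *~ c i).
pose t (psi : rep_ring G) : A := rtens psi z.
have tB : zmod_morphism t.
  by move=> x y; apply: (addIr (t y)); rewrite subrK /t -rtensDl subrK.
pose tA : {additive rep_ring G -> A} :=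
  HB.pack t (GRing.isZmodMorphism.Build _ _ t tB).
rewrite -[LHS]/(tA phi) phiE raddf_sum; apply: eq_bigr => i _.
rewrite raddfMz inZ_mul mulr1 /= /t.
pose t' (w : Z) : A := rtens (chiR i) w.
have tB' : zmod_morphism t'.
  by move=> x y; apply: (addIr (t' y)); rewrite subrK /t' -rtensDr subrK.
pose tA' : {additive Z -> A} := HB.pack t' (GRing.isZmodMorphism.Build _ _ t' tB').
by rewrite -[RHS]/(tA' _) raddfMz.
Qed.

(** The irreducible characters are linearly independent over the complex numbers,
    hence over [Z]. *)
Lemma evaluations_inj (a : A) :
  (forall g (eps : {rmorphism A -> Z}), g \in G -> is_eval g eps -> eps a = 0) ->
  a = 0.
Proof.
move=> a0; have [c aE] := rep_ring_xi_expansion a.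
suff c0 i : c i = 0 by rewrite aE big1 // => i _; rewrite c0 rmorph0 mul0r.
pose psi : 'CF(G) := \sum_i val (c i) *: 'chi_i.
have psi0 : psi = 0.
  apply/cfun_inP => g gG; rewrite cfunE.
  have [eps epsE] := exists_evaluation gG; have := congr1 val (a0 g eps gG epsE).
  rewrite aE rmorph0 rmorph_sum raddf_sum /psi sum_cfunE => psi_g0.
  rewrite -[RHS]psi_g0.
  by apply: eq_bigr => j _; rewrite inZ_mul [RHS]epsE mulr1 cfunE mulrC.
apply: val_inj; rewrite rmorph0 -[RHS](cfdot0l 'chi_i) -psi0 cfdot_suml.
rewrite (bigD1 i) //= cfdotZl cfdot_irr eqxx mulr1 big1 ?addr0 // => j /negPf ij.
by rewrite cfdotZl cfdot_irr ij mulr0.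
Qed.

(** If for each [g] some [a g] differed modulo [P] from its value at [g], the
    product over [G] of the elements [a g - inZ (value of a g at g)] would be
    outside [P], although all evaluations kill it. *)
Lemma exists_evaluation_mod (P : prime_idealr A) :
  exists2 eps : {rmorphism A -> Z},
    cancel inZ eps & forall a, a - inZ (eps a) \in P.
Proof.
have evalK g eps : g \in G -> is_eval g eps -> cancel inZ eps.
  by move=> gG epsE z; apply: val_inj; rewrite [LHS]epsE /= cfun1E gG mul1r.
have eval_uniq g eps eps' : is_eval g eps -> is_eval g eps' -> eps =1 eps'.
  move=> E E'; elim/rtens_ind => [phi z|a b IHa IHb].
    by apply: val_inj; rewrite E E'.
  by rewrite [LHS]rmorphD [RHS]rmorphD IHa IHb.
apply: contrapT => no_eps.
have /choice[a aP] (g : gT) : exists a : A, g \in G ->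
    exists2 eps, is_eval g eps & a - inZ (eps a) \notin P.
  have [gG|//] := boolP (g \in G); last by exists 0.
  have [eps epsE] := exists_evaluation gG.
  apply: contrapT => no_a; apply: no_eps; exists eps; first exact: evalK epsE.
  move=> a; apply: contrapT => /negP aP; apply: no_a; exists a => _.
  by exists eps.
(* [z g] is the value of [a g] at [g], with no reference to a chosen evaluation *)
have /choice[z zP] (g : gT) : exists z : Z, g \in G ->
    a g - inZ z \notin P /\ forall eps, is_eval g eps -> eps (a g) = z.
  have [gG|//] := boolP (g \in G); last by exists 0.
  have [eps epsE aPg] := aP g gG; exists (eps (a g)) => _; split=> // eps' epsE'.
  exact: eval_uniq epsE' epsE _.
have prod0 : \prod_(g in G) (a g - inZ (z g)) = 0.
  apply: evaluations_inj => g eps gG epsE; rewrite (bigD1 g) //=.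
  move: (\prod_(_ in G | _) _) => y.
  have e0 : eps (a g - inZ (z g)) = 0.
    have [_ zE] := zP g gG; transitivity (eps (a g) - eps (inZ (z g))).
      exact: rmorphB.
    by rewrite (zE eps epsE) (evalK g eps gG epsE (z g)) subrr.
  transitivity (eps (a g - inZ (z g)) * eps y); first exact: rmorphM.
  by rewrite e0 mul0r.
have : \prod_(g in G) (a g - inZ (z g)) \notin P.
  elim/big_ind: _ => [|x y xP yP|g gG]; first by rewrite idealr1.
    by rewrite prime_idealrM negb_or xP.
  by case: (zP g gG).
by rewrite prod0 idealr0.
Qed.

Lemma rep_ring_xi_spanned : exists s : seq A, forall a : A,
  exists c : nat -> Z, a = \sum_(i < size s) inZ (c i) * s`_i.
Proof.
exists (mkseq (fun i => rtens (chiR (inord i)) 1) (Nirr G)) => a.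
have [c ->] := rep_ring_xi_expansion a; exists (fun i => c (inord i)).
rewrite size_mkseq; apply: eq_bigr => i _.
by rewrite nth_mkseq ?inord_val //; apply: ltn_ord.
Qed.

End RepRing.

Theorem theorem1 (gT : finGroupType) (G : {group gT}) (n : nat) (xi : algC)
    (P : prime_idealr (rep_ring_xi G xi)) (p : nat) :
  #|G| = n -> n.-primitive_root xi ->
  closed_point P -> prime p -> p%:R \in P ->
  [/\ (p %| n)%N /\ (p <> 2%N \/ (4 %| n)%N) ->
        exists d : nat,
          [/\ has_dim (tangent (rep_ring_xi_in G xi) P) d,
              has_dim (tangent (intr : int -> rep_ring_xi G xi) P) d.+1
            & has_dim (cotangent P) d.+1],
      ~~ (p %| n)%N \/ (p = 2%N /\ ~~ (4 %| n)%N) ->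
        exists d : nat,
          [/\ has_dim (tangent (rep_ring_xi_in G xi) P) d,
              has_dim (tangent (intr : int -> rep_ring_xi G xi) P) d
            & has_dim (cotangent P) d.+1]
    & ((p %| n)%N /\ (p <> 2%N \/ (4 %| n)%N)
         <-> (p%:R : rep_ring_xi G xi) \in ideal_sq P)].
Proof.
move=> <- xi_prim _ p_pr pP; have G_gt0 := cardG_gt0 G.
have [eps inK eps_mod] := exists_evaluation_mod xi_prim P.
have [s s_span] := rep_ring_xi_spanned G xi.
have xi_sum := xiZ_sum xi_prim p_pr.
have [d [k [k_gt0 d_p p_d d_xi dP]]] :=
  exists_uniformizer p_pr G_gt0 (xiZ_unity xi_prim) xi_sum.
have d_neq0 : d <> 0.
  move=> d0; have [w] := d_p; rewrite d0 mul0r.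
  by apply: natr_int_adjoin_neq0; apply: prime_gt0.
have Z_Frob z := divides_Frobenius_fix p_pr d_p d_xi (int_adjoin_poly z).
have [ram_sq [r [dimZ dim_int dim_cot]]] := tangent_dimensions inK eps_mod p_pr
  k_gt0 pP (@int_adjoin_domain xi) d_neq0 d_p p_d Z_Frob s_span
  (intr : {rmorphism int -> rep_ring_xi G xi}) dP.
have ramP : reflect ((p %| #|G|)%N /\ (p <> 2%N \/ (4 %| #|G|)%N))
    ((p %| #|G|)%N && ((p != 2%N) || (4 %| #|G|)%N)).
  apply: (iffP andP) => -[pn H]; split=> //.
    by case/orP: H => [/eqP|]; [left | right].
  by apply/orP; case: H => [/eqP|]; [left | right].
split.
- by move=> /ramP ram; exists r; rewrite ram in dim_int.
- move=> unram; exists r.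
  suff ramF : ~~ ((p %| #|G|)%N && ((p != 2%N) || (4 %| #|G|)%N)).
    by rewrite (negPf ramF) in dim_int.
  rewrite negb_and negb_or negbK.
  by case: unram => [->|[/eqP-> ->]]; rewrite ?orbT.
- by rewrite -ram_sq; split=> [/ramP|/ramP].
Qed.
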